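(* Let $0\le\beta\le1$. Then $C_\beta[f]\in\mathcal{K}((1-\beta)/2)$ for every $f\in\mathcal{K}$. In particular, $C_\beta[f]\in\mathcal{K}$ for every $f\in\mathcal{K}$.
   Context: $\mathbb{D}$ is the open unit disk; $\mathcal{A}$ the class of analytic $f$ on $\mathbb{D}$ with $f(0)=0$, $f'(0)=1$. For $\lambda<1$, $\mathcal{K}(\lambda)=\{f\in\mathcal{A}: f'\ne0,\ \mathrm{Re}\,(1+zf''(z)/f'(z))>\lambda \text{ on }\mathbb{D}\}$, and $\mathcal{K}=\mathcal{K}(0)$ is the class of normalized convex univalent functions. For $\beta\ge0$ and $f$ analytic on $\mathbb{D}$ with $f(0)=0$, $C_\beta[f](z)=\int_0^z \frac{f(w)}{w(1-w)^\beta}\,dw$ (principal branch of $(1-w)^\beta$). *)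

(* Defs.v *)
From Stdlib Require Import Reals.
From Coquelicot Require Import Coquelicot.
Open Scope R_scope.

Definition in_disk (z : C) : Prop := Cmod z < 1.

Definition has_cderiv (f : C -> C) (z l : C) : Prop :=
  @is_derive C_AbsRing C_NormedModule f z l.

Definition analytic_on_disk (f : C -> C) : Prop :=
  forall z, in_disk z -> exists l, has_cderiv f z l.

Definition class_A (f : C -> C) : Prop :=
  analytic_on_disk f /\ f (RtoC 0) = RtoC 0 /\ has_cderiv f (RtoC 0) (RtoC 1).

(* Class K(lambda): f in A, f' <> 0 on D, Re (1 + z f''(z)/f'(z)) > lambda on D.
   f' and f'' denote the (unique) first and second complex derivatives on D. *)
Definition class_K (lam : R) (f : C -> C) : Prop :=
  class_A f /\
  exists f1 f2 : C -> C,
    forall z, in_disk z ->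
      has_cderiv f z (f1 z) /\ has_cderiv f1 z (f2 z) /\
      f1 z <> RtoC 0 /\
      lam < Re (Cplus (RtoC 1) (Cdiv (Cmult z (f2 z)) (f1 z))).

Definition cexp (z : C) : C :=
  (exp (Re z) * cos (Im z), exp (Re z) * sin (Im z)).

Definition parg (z : C) : R :=
  let x := Re z in let y := Im z in
  if Rlt_dec 0 x then atan (y / x)
  else if Rlt_dec x 0 then
         (if Rle_dec 0 y then atan (y / x) + PI else atan (y / x) - PI)
  else if Rlt_dec 0 y then PI / 2
  else if Rlt_dec y 0 then - (PI / 2)
  else 0.

Definition plog (z : C) : C := (ln (Cmod z), parg z).

Definition ppow (z : C) (b : R) : C := cexp (Cmult (RtoC b) (plog z)).

(* integrand  f(w) / (w (1-w)^beta).  At the single point w = 0 (t = 0 on the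
   segment) its value is junk, which does not affect the Riemann integral. *)
Definition Cbeta_integrand (beta : R) (f : C -> C) (w : C) : C :=
  Cdiv (f w) (Cmult w (ppow (Cminus (RtoC 1) w) beta)).

(* C_beta[f](z) = int_0^z f(w)/(w (1-w)^beta) dw, along the segment [0,z]:
   int_0^1 g(t z) z dt. *)
Definition Cbeta (beta : R) (f : C -> C) (z : C) : C :=
  @RInt C_R_CompleteNormedModule
    (fun t : R => Cmult (Cbeta_integrand beta f (Cmult (RtoC t) z)) z) 0 1.

(* Main.v *)
Require Import Defs.
From Stdlib Require Import Reals Lra Classical ClassicalEpsilon.
From Coquelicot Require Import Coquelicot.
Open Scope R_scope.

(* Put [q = f(z)/z].  Then [Cbeta f] has derivative [q / (1-z)^beta], so that
   [1 + z F''/F' = f'/q + beta z/(1-z)] for [F = Cbeta f].  The second term has real part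
   [> -beta/2], and the Marx-Strohhacker theorem [Re (z f'/f) > 1/2] handles the first.
   The latter follows from Jack's lemma for [w = 1 - f/(z f')]: at a point [z0] of maximal
   modulus of [w] on a circle one has [z0 w'(z0) = k w(z0)] with [k >= 1], and if
   [|w(z0)| >= 1], then [1 + z0 f''/f' = (1 + k w)/(1 - w)] would have real part [<= 0]. *)

(** * Continuity and derivatives of complex-valued functions *)

(** The quotients [f(z)/z] and [w(z)/z] both have a removable singularity at 0, and neither is
    formed by division. [q] is the mean of [f'] over the segment from 0 to [z], whose derivatives
    are again explicit means, and [w(z)/z] becomes [q'/f'], which is regular because [f'] has no
    zero. The maximal point on a circle must dominate the whole disk inside it, so a maximum
    principle is required. It rests on Cauchy's formula for circles about 0, proved by a homotopy
    from real integration alone. The same formula makes derivatives of holomorphic functions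
    holomorphic, which supplies the continuity needed to differentiate the means. Both halves of the
    constant (1 - beta)/2 have one origin: 1/(1 - w) maps the unit disk into the half-plane Re >
    1/2. Applied to the Schwarz function it gives the 1/2; applied to [z] itself, with z/(1 - z) =
    1/(1 - z) - 1, it gives the -beta/2. *)

Definition ccont {U : UniformSpace} (f : U -> C) (u : U) : Prop :=
  forall eps, 0 < eps -> locally u (fun v => Cmod (f v - f u) < eps).

Lemma ccont_const {U : UniformSpace} (c : C) (u : U) : ccont (fun _ => c) u.
Proof.
  intros e He. apply filter_forall; intros _.
  replace (c - c)%C with (RtoC 0) by ring. now rewrite Cmod_0.
Qed.

Lemma ccont_ext_loc {U : UniformSpace} (f g : U -> C) (u : U) :
  locally u (fun v => f v = g v) -> ccont f u -> ccont g u.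
Proof.
  intros Hfg Hf e He.
  pose proof (locally_singleton _ _ Hfg) as Hu.
  generalize (filter_and _ _ Hfg (Hf e He)). apply filter_imp.
  intros v [H1 H2]. now rewrite <- H1, <- Hu.
Qed.

Lemma ccont_ext {U : UniformSpace} (f g : U -> C) (u : U) :
  (forall v, f v = g v) -> ccont f u -> ccont g u.
Proof. intros H. apply ccont_ext_loc, filter_forall, H. Qed.

Lemma ccont_plus {U : UniformSpace} (f g : U -> C) (u : U) :
  ccont f u -> ccont g u -> ccont (fun v => f v + g v)%C u.
Proof.
  intros Hf Hg e He.
  assert (He2 : 0 < e / 2) by lra.
  generalize (filter_and _ _ (Hf _ He2) (Hg _ He2)). apply filter_imp.
  intros v [H1 H2].
  replace (f v + g v - (f u + g u))%C with ((f v - f u) + (g v - g u))%C by ring.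
  eapply Rle_lt_trans; [apply Cmod_triangle | lra].
Qed.

Lemma ccont_mult {U : UniformSpace} (f g : U -> C) (u : U) :
  ccont f u -> ccont g u -> ccont (fun v => f v * g v)%C u.
Proof.
  intros Hf Hg e He.
  pose (A := Cmod (f u)). pose (B := Cmod (g u)).
  assert (HA : 0 <= A) by apply Cmod_ge_0.
  assert (HB : 0 <= B) by apply Cmod_ge_0.
  pose (d := Rmin 1 (e / (A + B + 2))).
  assert (Hq : 0 < e / (A + B + 2)) by (apply Rdiv_lt_0_compat; lra).
  assert (Hd : 0 < d) by (apply Rmin_glb_lt; lra).
  assert (Hd1 : d <= 1) by apply Rmin_l.
  assert (Hd2 : d * (A + B + 2) <= e).
  { apply Rle_trans with (e / (A + B + 2) * (A + B + 2)).
    - apply Rmult_le_compat_r; [lra | apply Rmin_r].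
    - right; field; lra. }
  generalize (filter_and _ _ (Hf _ Hd) (Hg _ Hd)). apply filter_imp.
  intros v [H1 H2].
  replace (f v * g v - f u * g u)%C
    with ((f v - f u) * (g v - g u) + (f u * (g v - g u) + (f v - f u) * g u))%C by ring.
  eapply Rle_lt_trans; [apply Cmod_triangle |].
  eapply Rle_lt_trans; [apply Rplus_le_compat_l, Cmod_triangle |].
  rewrite !Cmod_mult. fold A B.
  pose proof (Cmod_ge_0 (f v - f u)). pose proof (Cmod_ge_0 (g v - g u)).
  nra.
Qed.

Lemma ccont_opp {U : UniformSpace} (f : U -> C) (u : U) :
  ccont f u -> ccont (fun v => - f v)%C u.
Proof.
  intros Hf. apply ccont_ext with (fun v => (- (1)) * f v)%C.
  - intros v; ring.
  - apply ccont_mult; [apply ccont_const | exact Hf].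
Qed.

Lemma ccont_minus {U : UniformSpace} (f g : U -> C) (u : U) :
  ccont f u -> ccont g u -> ccont (fun v => f v - g v)%C u.
Proof. intros Hf Hg. apply ccont_plus; [exact Hf | now apply ccont_opp]. Qed.

Lemma ccont_neq_0 {U : UniformSpace} (f : U -> C) (u : U) :
  ccont f u -> f u <> 0 -> locally u (fun v => f v <> 0).
Proof.
  intros Hf H0. generalize (Hf _ (proj1 (Cmod_gt_0 _) H0)). apply filter_imp.
  intros v Hv Hz. rewrite Hz in Hv.
  replace (0 - f u)%C with (- f u)%C in Hv by ring.
  rewrite Cmod_opp in Hv. lra.
Qed.

Lemma ccont_inv {U : UniformSpace} (f : U -> C) (u : U) :
  ccont f u -> f u <> 0 -> ccont (fun v => / f v)%C u.
Proof.
  intros Hf H0 e He.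
  pose (A := Cmod (f u)).
  assert (HA : 0 < A) by now apply Cmod_gt_0.
  (* The bound [A / 2] keeps |f v| above [A / 2]. The denominator |f v| |f u| then exceeds
     [A * A / 2], which the second bound turns into [e]. *)
  assert (H2 : 0 < Rmin (A / 2) (e * A * A / 2)).
  { apply Rmin_glb_lt; [lra |]. assert (0 < e * A * A) by now repeat apply Rmult_lt_0_compat. lra. }
  generalize (filter_and _ _ (ccont_neq_0 f u Hf H0) (Hf _ H2)). apply filter_imp.
  intros v [Hv H].
  assert (K1 := Rlt_le_trans _ _ _ H (Rmin_l _ _)).
  assert (K2 := Rlt_le_trans _ _ _ H (Rmin_r _ _)).
  replace (/ f v - / f u)%C with (- ((f v - f u) / (f v * f u)))%C by (field; split; assumption).
  rewrite Cmod_opp, Cmod_div, Cmod_mult by (apply Cmult_neq_0; assumption). fold A.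
  assert (K3 : A / 2 < Cmod (f v)).
  { assert (A <= Cmod (f v) + Cmod (f v - f u)); [| lra].
    unfold A. replace (f u) with (f v + - (f v - f u))%C at 1 by ring.
    eapply Rle_trans; [apply Cmod_triangle |]. rewrite Cmod_opp. lra. }
  apply Rlt_div_l; [nra |].
  apply Rlt_le_trans with (1 := K2).
  assert (0 < e * A) by nra. nra.
Qed.

Lemma ccont_div {U : UniformSpace} (f g : U -> C) (u : U) :
  ccont f u -> ccont g u -> g u <> 0 -> ccont (fun v => f v / g v)%C u.
Proof. intros Hf Hg H0. apply ccont_mult; [exact Hf | now apply ccont_inv]. Qed.

Lemma ccont_pow {U : UniformSpace} (f : U -> C) (u : U) (n : nat) :
  ccont f u -> ccont (fun v => f v ^ n)%C u.
Proof.
  intros Hf. induction n as [|n IH]; simpl.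
  - apply ccont_const.
  - now apply ccont_mult.
Qed.

(** Neighbourhoods in [C] are boxes of the product structure; the box of half-side [d / sqrt 2] lies
    inside the disk of radius [d]. *)
Lemma locally_C_intro (z : C) (P : C -> Prop) (d : R) :
  0 < d -> (forall w, Cmod (w - z) < d -> P w) -> locally z P.
Proof.
  intros Hd H.
  assert (Hs : 0 < sqrt 2) by (apply sqrt_lt_R0; lra).
  assert (He : 0 < d / sqrt 2) by now apply Rdiv_lt_0_compat.
  exists (mkposreal _ He). intros w Hw. apply H.
  apply C_NormedModule_mixin_compat2 in Hw. simpl in Hw.
  replace d with (sqrt 2 * (d / sqrt 2)) by (field; lra). exact Hw.
Qed.

Lemma locally_C_elim (z : C) (P : C -> Prop) :
  locally z P -> exists d, 0 < d /\ forall w, Cmod (w - z) < d -> P w.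
Proof.
  intros [d H]. exists d. split; [apply cond_pos |].
  intros w Hw. apply H, C_NormedModule_mixin_compat1, Hw.
Qed.

Lemma ccont_comp {U : UniformSpace} (f : U -> C) (g : C -> C) (u : U) :
  ccont f u -> ccont g (f u) -> ccont (fun v => g (f v)) u.
Proof.
  intros Hf Hg e He.
  destruct (locally_C_elim _ _ (Hg e He)) as [d [Hd H]].
  generalize (Hf d Hd). apply filter_imp. intros v Hv. now apply H.
Qed.

Lemma ccont_continuous {U : UniformSpace} (f : U -> C) (u : U) :
  ccont f u <-> @continuous U C_UniformSpace f u.
Proof.
  split.
  - intros H P HP. destruct (locally_C_elim _ _ HP) as [d [Hd H']].
    generalize (H d Hd). unfold filtermap. apply filter_imp. intros v Hv. now apply H'.
  - intros H e He. apply (H (fun w => Cmod (w - f u) < e)).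
    apply locally_C_intro with e; auto.
Qed.

Lemma ccont_id (z : C) : ccont (fun w : C => w) z.
Proof. intros e He. apply locally_C_intro with e; auto. Qed.

Lemma ccont_RtoC {U : UniformSpace} (f : U -> R) (u : U) :
  continuous f u -> ccont (fun v => RtoC (f v)) u.
Proof.
  intros H e He.
  generalize (H _ (locally_ball (f u) (mkposreal e He))). unfold filtermap.
  apply filter_imp. intros v Hv. rewrite <- RtoC_minus, Cmod_R. exact Hv.
Qed.

Lemma ccont_Re {U : UniformSpace} (f : U -> C) (u : U) :
  ccont f u -> continuous (fun v => Re (f v)) u.
Proof.
  intros H P [e He]. generalize (H e (cond_pos e)). unfold filtermap. apply filter_imp.
  intros v Hv. apply He. unfold ball; simpl; unfold AbsRing_ball, abs, minus, plus, opp; simpl.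
  apply Rle_lt_trans with (2 := Hv). eapply Rle_trans; [| apply re_le_Cmod]. right; f_equal.
Qed.

Lemma ccont_Im {U : UniformSpace} (f : U -> C) (u : U) :
  ccont f u -> continuous (fun v => Im (f v)) u.
Proof.
  intros H. apply continuous_ext with (fun v => Re (- Ci * f v)%C).
  - intros v. unfold Re, Im. simpl. ring.
  - apply ccont_Re. apply ccont_mult; [apply ccont_const | exact H].
Qed.

Lemma C_Re_Im (z : C) : z = (Re z + Ci * Im z)%C.
Proof. destruct z as [x y]. unfold Re, Im, Ci, RtoC, Cplus, Cmult; simpl. f_equal; ring. Qed.

Lemma ccont_pair {U : UniformSpace} (f g : U -> R) (u : U) :
  continuous f u -> continuous g u -> ccont (fun v => (f v, g v) : C) u.
Proof.
  intros Hf Hg. apply ccont_ext with (fun v => RtoC (f v) + Ci * RtoC (g v))%C.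
  - intros v. symmetry. exact (C_Re_Im (f v, g v)).
  - apply ccont_plus; [now apply ccont_RtoC |].
    apply ccont_mult; [apply ccont_const | now apply ccont_RtoC].
Qed.

Lemma ccont_Cmod {U : UniformSpace} (f : U -> C) (u : U) :
  ccont f u -> continuous (fun v => Cmod (f v)) u.
Proof.
  intros H P [e He]. generalize (H e (cond_pos e)). unfold filtermap. apply filter_imp.
  intros v Hv. apply He. unfold ball; simpl; unfold AbsRing_ball, abs, minus, plus, opp; simpl.
  apply Rle_lt_trans with (2 := Hv). apply Rabs_le.
  assert (H1 := Cmod_triangle (f v - f u) (f u)).
  assert (H2 := Cmod_triangle (- (f v - f u)) (f v)).
  rewrite Cmod_opp in H2.
  replace (f v - f u + f u)%C with (f v) in H1 by ring.
  replace (- (f v - f u) + f v)%C with (f u) in H2 by ring. lra.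
Qed.

(* Caratheodory's form of the derivative: all rules reduce to algebra and continuity.
   Taking [i] to be the identity of [C] or [RtoC] covers complex and real variables at once. *)
Definition der {U : UniformSpace} (i f : U -> C) (u : U) (l : C) : Prop :=
  exists phi : U -> C,
    (forall v, f v = f u + (i v - i u) * phi v)%C /\ phi u = l /\ ccont phi u.

Notation cder := (der (U := C_UniformSpace) (fun z : C => z)).
Notation rder := (der (U := R_UniformSpace) RtoC).

Section der_rules.
Context {U : UniformSpace} (i : U -> C) (u : U) (Hi : ccont i u).

Lemma der_ext (f g : U -> C) (l : C) : (forall v, f v = g v) -> der i f u l -> der i g u l.
Proof.
  intros H [p [H1 H2]]. exists p. split; [| exact H2]. intros v. rewrite <- !H. apply H1.
Qed.

Lemma der_eq (f : U -> C) (l l' : C) : der i f u l -> l = l' -> der i f u l'.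
Proof. now intros H <-. Qed.

Lemma der_const (c : C) : der i (fun _ => c) u 0.
Proof. exists (fun _ => RtoC 0). repeat split; [intros; ring | apply ccont_const]. Qed.

Lemma der_self : der i i u 1.
Proof. exists (fun _ => RtoC 1). repeat split; [intros; ring | apply ccont_const]. Qed.

Lemma der_ccont (f : U -> C) (l : C) : der i f u l -> ccont f u.
Proof.
  intros [p [H1 [_ H3]]]. apply ccont_ext with (fun v => f u + (i v - i u) * p v)%C.
  - intros v; symmetry; apply H1.
  - apply ccont_plus; [apply ccont_const |]. apply ccont_mult; [| exact H3].
    apply ccont_minus; [exact Hi | apply ccont_const].
Qed.

Lemma der_plus (f g : U -> C) (l m : C) :
  der i f u l -> der i g u m -> der i (fun v => f v + g v)%C u (l + m)%C.
Proof.
  intros [p [H1 [H2 H3]]] [q [K1 [K2 K3]]]. exists (fun v => p v + q v)%C. repeat split.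
  - intros v. rewrite (H1 v), (K1 v). ring.
  - now rewrite H2, K2.
  - now apply ccont_plus.
Qed.

Lemma der_mult (f g : U -> C) (l m : C) :
  der i f u l -> der i g u m -> der i (fun v => f v * g v)%C u (l * g u + f u * m)%C.
Proof.
  intros Hf Hg. pose proof (der_ccont _ _ Hg) as Cg. revert Hf Hg.
  intros [p [H1 [H2 H3]]] [q [K1 [K2 K3]]].
  exists (fun v => p v * g v + f u * q v)%C. repeat split.
  - intros v. rewrite (H1 v), (K1 v). ring.
  - now rewrite H2, K2.
  - apply ccont_plus; apply ccont_mult; auto. apply ccont_const.
Qed.

Lemma der_scal (c : C) (f : U -> C) (l : C) :
  der i f u l -> der i (fun v => c * f v)%C u (c * l)%C.
Proof.
  intros H. apply der_eq with (0 * f u + c * l)%C; [| ring].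
  apply der_mult; [apply der_const | exact H].
Qed.

Lemma der_opp (f : U -> C) (l : C) : der i f u l -> der i (fun v => - f v)%C u (- l)%C.
Proof.
  intros H. apply der_ext with (fun v => (- (1)) * f v)%C; [intros; ring |].
  apply der_eq with ((- (1)) * l)%C; [now apply der_scal | ring].
Qed.

Lemma der_minus (f g : U -> C) (l m : C) :
  der i f u l -> der i g u m -> der i (fun v => f v - g v)%C u (l - m)%C.
Proof. intros Hf Hg. apply der_plus; [exact Hf | now apply der_opp]. Qed.

Lemma der_comp (f : U -> C) (g : C -> C) (l m : C) :
  der i f u l -> cder g (f u) m -> der i (fun v => g (f v)) u (l * m)%C.
Proof.
  intros Hf. pose proof (der_ccont _ _ Hf) as Cf. revert Hf.
  intros [p [H1 [H2 H3]]] [q [K1 [K2 K3]]].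
  exists (fun v => p v * q (f v))%C. repeat split.
  - intros v. rewrite (K1 (f v)), (H1 v) at 1. ring.
  - now rewrite H2, K2.
  - apply ccont_mult; [exact H3 | now apply ccont_comp].
Qed.
End der_rules.

(** The factorization in [der] is global while [f] and [g] agree only near [u]. Where they differ,
    the slope is redefined as the difference quotient of [g], meaningful since [i] takes the value
    [i u] only at [u]; near [u] the slope is unchanged. *)
Lemma der_ext_loc {U : UniformSpace} (i f g : U -> C) (u : U) (l : C) :
  (forall v, i v = i u -> v = u) ->
  locally u (fun v => f v = g v) -> der i f u l -> der i g u l.
Proof.
  intros Hinj H [p [H1 [H2 H3]]].
  pose proof (locally_singleton _ _ H) as Hu.
  exists (fun v => if excluded_middle_informative (f v = g v) then p v
                   else ((g v - g u) / (i v - i u))%C).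
  repeat split.
  - intros v. destruct (excluded_middle_informative (f v = g v)) as [E | E].
    + rewrite <- E, <- Hu. apply H1.
    + assert (i v - i u <> 0)%C.
      { intros E'. apply E. rewrite (Hinj v); [exact Hu |].
        replace (i v) with (i v - i u + i u)%C by ring. rewrite E'. ring. }
      field; assumption.
  - destruct (excluded_middle_informative (f u = g u)); [exact H2 | contradiction].
  - apply ccont_ext_loc with (2 := H3). revert H. apply filter_imp. intros v Hv.
    destruct (excluded_middle_informative (f v = g v)); [reflexivity | contradiction].
Qed.

Lemma cder_ext_loc (f g : C -> C) (z l : C) :
  locally z (fun w => f w = g w) -> cder f z l -> cder g z l.
Proof. apply der_ext_loc. auto. Qed.

Lemma cder_ccont (f : C -> C) (z l : C) : cder f z l -> ccont f z.
Proof. apply der_ccont, ccont_id. Qed.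

Lemma cder_inv (z : C) : z <> 0 -> cder Cinv z (- / (z * z))%C.
Proof.
  intros H0.
  (* The factorization must hold even at [w = 0], where [/ w] has no meaning. There the inverse is
     replaced by its tangent at [z], with constant slope; this alters nothing near [z]. *)
  apply cder_ext_loc with
    (fun w => if Ceq_dec w 0 then (/ z - (w - z) / (z * z))%C else (/ w)%C).
  { generalize (ccont_neq_0 (fun w => w) z (ccont_id z) H0). apply filter_imp.
    intros w Hw. destruct (Ceq_dec w 0); [contradiction | reflexivity]. }
  exists (fun w => if Ceq_dec w 0 then (- / (z * z))%C else (- / (w * z))%C).
  repeat split.
  - intros w. destruct (Ceq_dec z 0); [contradiction |].
    destruct (Ceq_dec w 0); field; auto.
  - destruct (Ceq_dec z 0); [contradiction | reflexivity].
  - apply ccont_ext_loc with (fun w : C => - / (w * z))%C.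
    + generalize (ccont_neq_0 (fun w => w) z (ccont_id z) H0). apply filter_imp.
      intros w Hw. destruct (Ceq_dec w 0); [contradiction | reflexivity].
    + apply ccont_opp, ccont_inv; [| now apply Cmult_neq_0].
      apply ccont_mult; [apply ccont_id | apply ccont_const].
Qed.

Lemma der_inv {U : UniformSpace} (i f : U -> C) (u : U) (l : C) :
  ccont i u -> der i f u l -> f u <> 0 ->
  der i (fun v => / f v)%C u (- l / (f u * f u))%C.
Proof.
  intros Hi Hf H0. apply der_eq with (l * (- / (f u * f u)))%C; [| field; assumption].
  apply (der_comp i u Hi f Cinv); [exact Hf | now apply cder_inv].
Qed.

Lemma der_div {U : UniformSpace} (i f g : U -> C) (u : U) (l m : C) :
  ccont i u -> der i f u l -> der i g u m -> g u <> 0 ->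
  der i (fun v => f v / g v)%C u ((l * g u - f u * m) / (g u * g u))%C.
Proof.
  intros Hi Hf Hg H0.
  apply der_eq with (l * / g u + f u * (- m / (g u * g u)))%C; [| field; assumption].
  apply (der_mult i u Hi f (fun v => / g v)%C); [exact Hf | now apply der_inv].
Qed.

Lemma der_pow {U : UniformSpace} (i f : U -> C) (u : U) (l : C) (n : nat) :
  ccont i u -> der i f u l ->
  der i (fun v => f v ^ n)%C u (INR n * f u ^ pred n * l)%C.
Proof.
  intros Hi Hf. induction n as [|n IH].
  - apply der_eq with (RtoC 0); [exact (der_const i u 1%C) | simpl; ring].
  - apply der_eq with (l * f u ^ n + f u * (INR n * f u ^ pred n * l))%C.
    + exact (der_mult i u Hi f (fun v => f v ^ n)%C _ _ Hf IH).
    + rewrite S_INR, RtoC_plus. destruct n as [|n]; simpl Nat.pred; [simpl; ring |].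
      rewrite Cpow_S. ring.
Qed.

Lemma der_of_little_o {U : UniformSpace} (i f : U -> C) (u : U) (l : C) :
  (forall v, i v = i u -> v = u) ->
  (forall eps, 0 < eps -> locally u (fun v =>
     Cmod (f v - f u - (i v - i u) * l) <= eps * Cmod (i v - i u))) ->
  der i f u l.
Proof.
  intros Hinj H.
  exists (fun v => if excluded_middle_informative (v = u) then l
                   else ((f v - f u) / (i v - i u))%C).
  assert (Hne : forall v, v <> u -> (i v - i u <> 0)%C).
  { intros v Hv E. apply Hv, Hinj.
    replace (i v) with (i v - i u + i u)%C by ring. rewrite E. ring. }
  repeat split.
  - intros v. destruct (excluded_middle_informative (v = u)) as [-> | E]; [ring |].
    field. now apply Hne.
  - destruct (excluded_middle_informative (u = u)); [reflexivity | contradiction].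
  - intros e He.
    assert (He2 : 0 < e / 2) by lra.
    generalize (H _ He2). apply filter_imp. intros v Hv.
    destruct (excluded_middle_informative (u = u)) as [_ |]; [| contradiction].
    destruct (excluded_middle_informative (v = u)) as [-> | E].
    + replace (l - l)%C with (RtoC 0) by ring. now rewrite Cmod_0.
    + pose proof (Hne v E) as Hn.
      replace ((f v - f u) / (i v - i u) - l)%C
        with ((f v - f u - (i v - i u) * l) / (i v - i u))%C by (field; assumption).
      rewrite Cmod_div by assumption.
      apply Cmod_gt_0 in Hn. apply Rlt_div_l; [assumption |]. nra.
Qed.

Lemma der_little_o {U : UniformSpace} (i f : U -> C) (u : U) (l : C) :
  der i f u l -> forall eps, 0 < eps -> locally u (fun v =>
     Cmod (f v - f u - (i v - i u) * l) <= eps * Cmod (i v - i u)).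
Proof.
  intros [p [H1 [H2 H3]]] e He. generalize (H3 e He). apply filter_imp. intros v Hv.
  rewrite (H1 v), <- H2.
  replace (f u + (i v - i u) * p v - f u - (i v - i u) * p u)%C
    with ((i v - i u) * (p v - p u))%C by ring.
  rewrite Cmod_mult, Rmult_comm. apply Rmult_le_compat_r; [apply Cmod_ge_0 | lra].
Qed.

(** [has_cderiv] uses the neighbourhoods given by the modulus, [cder] those of the product of two
    lines; [locally_C] identifies the two filters, and the rest is the little-o form of the
    derivative. *)
Lemma has_cderiv_cder (f : C -> C) (z l : C) : has_cderiv f z l <-> cder f z l.
Proof.
  split.
  - intros [_ H]. apply der_of_little_o; [auto |]. intros e He.
    apply locally_C.
    generalize (H z (fun P HP => HP) (mkposreal e He)). apply filter_imp.
    intros w Hw. exact Hw.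
  - intros H. split; [apply is_linear_scal_l |].
    intros x Hx.
    assert (E : z = x) by (apply (@is_filter_lim_locally_unique _ (AbsRing_NormedModule C_AbsRing)); exact Hx).
    subst x. intros e.
    apply (locally_C z). generalize (der_little_o _ _ _ _ H e (cond_pos e)).
    apply filter_imp. intros w Hw. exact Hw.
Qed.

Lemma rder_is_derive (f : R -> C) (t : R) (l : C) :
  rder f t l -> @is_derive R_AbsRing C_R_NormedModule f t l.
Proof.
  intros H. split; [apply is_linear_scal_l |].
  intros x Hx. apply (@is_filter_lim_locally_unique R_AbsRing R_NormedModule) in Hx. subst x.
  intros e. generalize (der_little_o _ _ _ _ H e (cond_pos e)).
  apply filter_imp. intros s Hs. rewrite <- Cmod_norm.
  rewrite <- RtoC_minus, Cmod_R in Hs.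
  eapply Rle_trans; [| exact Hs]. right. f_equal.
  unfold minus, plus, opp, scal, Cminus, Cplus, Copp, Cmult, RtoC; simpl. unfold prod_plus, prod_opp, prod_scal. simpl.
  unfold scal, plus, opp, mult; simpl. unfold mult; simpl. f_equal; ring.
Qed.

Lemma cder_unique (f : C -> C) (z l m : C) : cder f z l -> cder f z m -> l = m.
Proof.
  intros H K. apply has_cderiv_cder in H, K.
  apply is_C_derive_unique in H. apply is_C_derive_unique in K. congruence.
Qed.

Lemma ccont_RtoC_id (t : R) : ccont RtoC t.
Proof. apply ccont_RtoC, continuous_id. Qed.

Lemma rder_Re (f : R -> C) (t : R) (l : C) :
  rder f t l -> is_derive (fun s => Re (f s)) t (Re l).
Proof.
  intros H. apply rder_is_derive in H.
  apply (filterdiff_ext_lin _ (fun y : R => Re (scal y l : C_R_NormedModule))).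
  - apply (filterdiff_comp f (fun z : C_R_NormedModule => fst z) _ (fun z : C_R_NormedModule => fst z)).
    + exact H.
    + apply filterdiff_linear, is_linear_fst.
  - intros y. reflexivity.
Qed.

(* The usual reduction to a real function: project on the direction of [f b - f a]. *)
Lemma rder_MVT (f df : R -> C) (a b : R) (M : R) :
  a <= b -> (forall t, a <= t <= b -> rder f t (df t)) ->
  (forall t, a <= t <= b -> Cmod (df t) <= M) -> Cmod (f b - f a) <= M * (b - a).
Proof.
  intros Hab Hd HM.
  pose (D := Cconj (f b - f a)).
  destruct (MVT_gen (fun t => Re (D * f t)%C) a b (fun t => Re (D * df t)%C)) as [c [Hc H]].
  - rewrite Rmin_left, Rmax_right by lra. intros x Hx.
    apply rder_Re. apply (der_scal RtoC); [apply ccont_RtoC_id | apply Hd; lra].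
  - rewrite Rmin_left, Rmax_right by lra. intros x Hx.
    apply continuity_pt_filterlim. apply (ccont_Re (fun t => D * f t)%C).
    apply ccont_mult; [apply ccont_const |].
    eapply der_ccont; [apply ccont_RtoC_id | apply Hd; lra].
  - rewrite Rmin_left, Rmax_right in Hc by lra.
    assert (E : Re (D * f b)%C - Re (D * f a)%C = Cmod (f b - f a) ^ 2).
    { unfold D. rewrite Cmod2_alt. unfold Re, Im, Cconj, Cmult, Cminus, Cplus, Copp; simpl. ring. }
    rewrite E in H.
    assert (K : Re (D * df c)%C <= Cmod (f b - f a) * M).
    { eapply Rle_trans; [apply Rle_abs |]. eapply Rle_trans; [apply re_le_Cmod |].
      rewrite Cmod_mult. unfold D. rewrite Cmod_conj.
      apply Rmult_le_compat_l; [apply Cmod_ge_0 | now apply HM]. }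
    pose proof (Cmod_ge_0 (f b - f a)) as P.
    destruct (Rle_lt_or_eq_dec _ _ P) as [P' | P'].
    + apply Rmult_le_reg_l with (1 := P'). nra.
    + rewrite <- P'. apply Rmult_le_pos; [| lra].
      apply Rle_trans with (Cmod (df c)); [apply Cmod_ge_0 | now apply HM].
Qed.

Lemma rder_line (f : C -> C) (p d l : C) (t : R) :
  cder f (p + t * d)%C l -> rder (fun s : R => f (p + s * d)%C) t (d * l)%C.
Proof.
  intros H. apply (der_comp RtoC t (ccont_RtoC_id t) (fun s : R => p + s * d)%C f); [| exact H].
  apply der_eq with (0 + (1 * d + t * 0))%C; [| ring].
  apply (der_plus RtoC t (fun _ => p) (fun s : R => s * d)%C); [apply der_const |].
  apply (der_mult RtoC t (ccont_RtoC_id t) RtoC (fun _ => d)); [apply der_self | apply der_const].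
Qed.

(** * Integrals of complex-valued functions *)

Notation ex_cint := (@ex_RInt C_R_NormedModule).
Notation cint := (@RInt C_R_CompleteNormedModule).

Lemma ex_cint_ccont (f : R -> C) (a b : R) :
  a <= b -> (forall t, a <= t <= b -> ccont f t) -> ex_cint f a b.
Proof.
  intros Hab H. apply (@ex_RInt_continuous C_R_CompleteNormedModule).
  rewrite Rmin_left, Rmax_right by assumption.
  intros t Ht. apply ccont_continuous, H, Ht.
Qed.

(** Integration takes place in [C] as a real module, where scalars are real; a complex factor
    therefore acts through real and imaginary parts. *)
Lemma is_RInt_Cmult_l (c : C) (f : R -> C) (a b : R) (l : C) :
  @is_RInt C_R_NormedModule f a b l ->
  @is_RInt C_R_NormedModule (fun t => c * f t)%C a b (c * l)%C.
Proof.
  intros H.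
  pose proof (is_RInt_fct_extend_fst f a b l H) as H1.
  pose proof (is_RInt_fct_extend_snd f a b l H) as H2.
  apply (is_RInt_fct_extend_pair (U := R_NormedModule) (V := R_NormedModule)).
  - apply (is_RInt_minus (V := R_NormedModule) (fun t => fst c * fst (f t)) (fun t => snd c * snd (f t))).
    + now apply (is_RInt_scal (V := R_NormedModule)).
    + now apply (is_RInt_scal (V := R_NormedModule)).
  - apply (is_RInt_plus (V := R_NormedModule) (fun t => fst c * snd (f t)) (fun t => snd c * fst (f t))).
    + now apply (is_RInt_scal (V := R_NormedModule)).
    + now apply (is_RInt_scal (V := R_NormedModule)).
Qed.

Lemma cint_scal (c : C) (f : R -> C) (a b : R) :
  ex_cint f a b -> cint (fun t => c * f t)%C a b = (c * cint f a b)%C.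
Proof.
  intros H. apply is_RInt_unique, is_RInt_Cmult_l.
  now apply (@RInt_correct C_R_CompleteNormedModule).
Qed.

Lemma cint_minus (f g : R -> C) (a b : R) :
  ex_cint f a b -> ex_cint g a b ->
  cint (fun t => f t - g t)%C a b = (cint f a b - cint g a b)%C.
Proof. apply (@RInt_minus C_R_CompleteNormedModule). Qed.

Lemma cint_le (f : R -> C) (a b M : R) :
  a <= b -> ex_cint f a b -> (forall t, a <= t <= b -> Cmod (f t) <= M) ->
  Cmod (cint f a b) <= (b - a) * M.
Proof.
  intros Hab Hex H. rewrite Cmod_norm.
  apply (norm_RInt_le_const (V := C_R_NormedModule) f); [assumption | |].
  - intros t Ht. rewrite <- Cmod_norm. now apply H.
  - now apply (@RInt_correct C_R_CompleteNormedModule).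
Qed.

Lemma cint_ext (f g : R -> C) (a b : R) :
  a <= b -> (forall t, a < t < b -> f t = g t) -> cint f a b = cint g a b.
Proof.
  intros Hab H. apply RInt_ext. rewrite Rmin_left, Rmax_right by assumption. exact H.
Qed.

Lemma cint_const (c : C) (a b : R) : cint (fun _ => c) a b = ((b - a)%R * c)%C.
Proof.
  rewrite RInt_const. unfold scal, RtoC, Cmult; simpl. unfold prod_scal, scal; simpl.
  unfold mult; simpl. f_equal; ring.
Qed.

Lemma cint_FTC (F f : R -> C) (a b : R) :
  a <= b -> (forall t, a <= t <= b -> rder F t (f t)) ->
  (forall t, a <= t <= b -> ccont f t) -> cint f a b = (F b - F a)%C.
Proof.
  intros Hab H1 H2. apply is_RInt_unique.
  apply (is_RInt_derive (V := C_R_CompleteNormedModule) F f);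
    rewrite Rmin_left, Rmax_right by assumption; intros t Ht.
  - now apply rder_is_derive, H1.
  - now apply ccont_continuous, H2.
Qed.

(** * Differentiation under the integral sign *)

Notation jointly_ccont K := (ccont (U := prod_UniformSpace R_UniformSpace C_UniformSpace)
  (fun p : R * C => K (fst p) (snd p))).

(** Joint continuity at each point (t, z0) gives a gauge [delta t], and compactness of the interval
    gives a positive lower bound [d] for the gauges at suitable tags. Both [K t z] and [K t z0] are
    compared with [K s z0] at a nearby tag [s]. *)
Lemma jointly_ccont_unif (K : R -> C -> C) (a b : R) (z0 : C) :
  (forall t, a <= t <= b -> jointly_ccont K (t, z0)) ->
  forall eps, 0 < eps -> exists d, 0 < d /\ forall t, a <= t <= b ->
    forall z, Cmod (z - z0) < d -> Cmod (K t z - K t z0) <= eps.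
Proof.
  intros H e He.
  assert (He2 : 0 < e / 2) by lra.
  assert (Hd : forall t, exists d : posreal, a <= t <= b ->
      forall s z, Rabs (s - t) < d -> Cmod (z - z0) < d -> Cmod (K s z - K t z0) < e / 2).
  { intros t. destruct (classic (a <= t <= b)) as [Ht | Ht].
    - destruct (H t Ht _ He2) as [d Hd]. exists d. intros _ s z Hs Hz.
      apply (Hd (s, z)). split; [exact Hs |].
      apply C_NormedModule_mixin_compat1. exact Hz.
    - exists (mkposreal 1 Rlt_0_1). tauto. }
  pose (delta := fun t => proj1_sig (constructive_indefinite_description _ (Hd t))).
  assert (Hdelta : forall t, a <= t <= b -> forall s z, Rabs (s - t) < delta t ->
      Cmod (z - z0) < delta t -> Cmod (K s z - K t z0) < e / 2).
  { intros t. exact (proj2_sig (constructive_indefinite_description _ (Hd t))). }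
  destruct (compactness_value_1d a b delta) as [d Hc].
  exists d. split; [apply cond_pos |]. intros t Ht z Hz.
  (* The tag [s] is delivered only under a double negation. *)
  apply NNPP. intros Hn. apply (Hc t Ht). intros [s [Hs [Hst Hds]]]. apply Hn.
  replace (K t z - K t z0)%C with ((K t z - K s z0) + - (K t z0 - K s z0))%C by ring.
  eapply Rle_trans; [apply Cmod_triangle |]. rewrite Cmod_opp.
  assert (Cmod (K t z - K s z0) < e / 2) by (apply Hdelta; auto; lra).
  assert (Cmod (K t z0 - K s z0) < e / 2); [| lra].
  apply Hdelta; auto. replace (z0 - z0)%C with (RtoC 0) by ring. rewrite Cmod_0. apply cond_pos.
Qed.

(** The linearization error of [K t] at [z0] is controlled, by the mean value inequality on the
    segment from [z0] to [z], by the oscillation of [K' t] there, and this is small uniformly in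
    [t]. *)
Lemma cder_cint_param (K K' : R -> C -> C) (a b : R) (z0 : C) (r : R) :
  a <= b -> 0 < r ->
  (forall t z, a <= t <= b -> Cmod (z - z0) < r -> cder (K t) z (K' t z)) ->
  (forall t z, a <= t <= b -> Cmod (z - z0) < r -> ccont (fun s => K s z) t) ->
  (forall t, a <= t <= b -> jointly_ccont K' (t, z0)) ->
  cder (fun z => cint (fun t => K t z) a b) z0 (cint (fun t => K' t z0) a b).
Proof.
  intros Hab Hr HK HKt HK'.
  assert (Hz0 : Cmod (z0 - z0) < r).
  { replace (z0 - z0)%C with (RtoC 0) by ring. now rewrite Cmod_0. }
  assert (Hex : forall z, Cmod (z - z0) < r -> ex_cint (fun t => K t z) a b).
  { intros z Hz. apply ex_cint_ccont; [assumption |]. intros t Ht. now apply HKt. }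
  assert (HK't : forall t, a <= t <= b -> ccont (fun s => K' s z0) t).
  { intros t Ht e He. destruct (HK' t Ht e He) as [d Hd].
    exists d. intros s Hs. apply (Hd (s, z0)). split; [exact Hs | apply ball_center]. }
  assert (Hex' : ex_cint (fun t => K' t z0) a b) by now apply ex_cint_ccont.
  apply der_of_little_o; [auto |]. intros e He.
  (* The summand 1 keeps the divisor positive when [a = b]. *)
  assert (He' : 0 < e / (b - a + 1)) by (apply Rdiv_lt_0_compat; lra).
  destruct (jointly_ccont_unif K' a b z0 HK' _ He') as [d [Hd Hu]].
  apply locally_C_intro with (Rmin d r); [now apply Rmin_glb_lt |].
  intros z Hz.
  assert (Hz1 := Rlt_le_trans _ _ _ Hz (Rmin_l _ _)).
  assert (Hz2 := Rlt_le_trans _ _ _ Hz (Rmin_r _ _)).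
  rewrite <- cint_scal by assumption.
  rewrite <- cint_minus by auto.
  assert (Hes : ex_cint (fun t => (z - z0) * K' t z0)%C a b).
  { eexists. apply is_RInt_Cmult_l. now apply (@RInt_correct C_R_CompleteNormedModule). }
  rewrite <- cint_minus; [| | assumption].
  2:{ apply (@ex_RInt_minus C_R_NormedModule); auto. }
  apply Rle_trans with ((b - a) * (e / (b - a + 1) * Cmod (z - z0))).
  - apply cint_le; [assumption | |].
    + apply (@ex_RInt_minus C_R_NormedModule); [| assumption].
      apply (@ex_RInt_minus C_R_NormedModule); auto.
    + intros t Ht.
      (* Along the segment the linear part is subtracted before the mean value inequality is
         applied, so that only the difference of two values of [K' t] has to be bounded. *)
      pose (g := fun s : R => (K t (z0 + s * (z - z0)) - s * ((z - z0) * K' t z0))%C).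
      replace (K t z - K t z0 - (z - z0) * K' t z0)%C with (g 1 - g 0)%C.
      2:{ unfold g. replace (z0 + 1 * (z - z0))%C with z by ring.
          replace (z0 + 0 * (z - z0))%C with z0 by ring. ring. }
      replace (e / (b - a + 1) * Cmod (z - z0)) with (e / (b - a + 1) * Cmod (z - z0) * (1 - 0)) by ring.
      assert (Hseg : forall s, 0 <= s <= 1 -> Cmod (z0 + s * (z - z0) - z0) <= Cmod (z - z0)).
      { intros s Hs. replace (z0 + s * (z - z0) - z0)%C with (s * (z - z0))%C by ring.
        rewrite Cmod_mult, Cmod_R, Rabs_pos_eq by lra.
        pose proof (Cmod_ge_0 (z - z0)). nra. }
      apply rder_MVT with (fun s : R => ((z - z0) * K' t (z0 + s * (z - z0))
                                        - (z - z0) * K' t z0)%C); [lra | |].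
      * intros s Hs. unfold g.
        apply (der_minus RtoC s (ccont_RtoC_id s) (fun s : R => K t (z0 + s * (z - z0))%C)
          (fun s : R => s * ((z - z0) * K' t z0))%C).
        -- apply rder_line, HK; [assumption |].
           eapply Rle_lt_trans; [now apply Hseg | assumption].
        -- apply der_eq with (1 * ((z - z0) * K' t z0) + s * 0)%C; [| ring].
           apply (der_mult RtoC s (ccont_RtoC_id s) RtoC (fun _ => (z - z0) * K' t z0)%C);
             [apply der_self | apply der_const].
      * intros s Hs.
        replace ((z - z0) * K' t (z0 + s * (z - z0)) - (z - z0) * K' t z0)%C
          with ((z - z0) * (K' t (z0 + s * (z - z0)) - K' t z0))%C by ring.
        rewrite Cmod_mult, Rmult_comm. apply Rmult_le_compat_r; [apply Cmod_ge_0 |].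
        apply Hu; [assumption |]. eapply Rle_lt_trans; [now apply Hseg | assumption].
  - rewrite <- Rmult_assoc. apply Rmult_le_compat_r; [apply Cmod_ge_0 |].
    assert (E : e = e / (b - a + 1) * (b - a + 1)) by (field; lra). nra.
Qed.

(** * Cauchy's formula on circles centred at the origin *)

Lemma ccont_comp_R {U : UniformSpace} (g : U -> R) (f : R -> C) (u : U) :
  continuous g u -> ccont f (g u) -> ccont (fun v => f (g v)) u.
Proof. intros Hg Hf e He. exact (Hg _ (Hf e He)). Qed.

Lemma ccont_fst {U : UniformSpace} (f : R -> C) (p : R * U) :
  ccont f (fst p) -> ccont (U := prod_UniformSpace R_UniformSpace U) (fun q => f (fst q)) p.
Proof. intros H. apply ccont_comp_R; [destruct p; apply continuous_fst | exact H]. Qed.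

Lemma ccont_snd (p : R * C) :
  ccont (U := prod_UniformSpace R_UniformSpace C_UniformSpace) (fun q => snd q) p.
Proof. apply ccont_continuous. destruct p; apply (continuous_snd (V := C_UniformSpace)). Qed.

Lemma rder_RtoC (f : R -> R) (t l : R) : is_derive f t l -> rder (fun s => RtoC (f s)) t l.
Proof.
  intros [_ H]. apply der_of_little_o.
  - intros v E. now apply RtoC_inj.
  - intros e He. generalize (H t (fun P HP => HP) (mkposreal e He)). apply filter_imp.
    intros s Hs. rewrite <- !RtoC_minus, <- RtoC_mult, <- RtoC_minus, !Cmod_R. exact Hs.
Qed.

Definition circ (r t : R) : C := (r * cos t, r * sin t).

Lemma rder_circ (r t : R) : rder (circ r) t (Ci * circ r t)%C.
Proof.
  apply der_ext with (fun s => RtoC (r * cos s) + Ci * RtoC (r * sin s))%C.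
  { intros s. symmetry. exact (C_Re_Im (r * cos s, r * sin s)). }
  apply der_eq with (RtoC (r * - sin t) + Ci * RtoC (r * cos t))%C.
  - apply (der_plus RtoC t (fun s => RtoC (r * cos s)) (fun s => Ci * RtoC (r * sin s))%C).
    + apply rder_RtoC. apply is_derive_scal. auto_derive; [trivial | ring].
    + apply (der_scal RtoC t (ccont_RtoC_id t) Ci (fun s => RtoC (r * sin s))).
      apply rder_RtoC. apply is_derive_scal. auto_derive; [trivial | ring].
  - unfold circ, Ci, RtoC, Cmult, Cplus; simpl. f_equal; ring.
Qed.

Lemma ccont_circ (r t : R) : ccont (circ r) t.
Proof. eapply der_ccont; [apply ccont_RtoC_id | apply rder_circ]. Qed.

Lemma Cmod_circ (r t : R) : 0 <= r -> Cmod (circ r t) = r.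
Proof.
  intros Hr. unfold Cmod, circ; simpl. pose proof (sin2_cos2 t) as E. unfold Rsqr in E.
  replace (r * cos t * (r * cos t * 1) + r * sin t * (r * sin t * 1)) with (r * r) by nra.
  now apply sqrt_square.
Qed.

Lemma circ_periodic (r : R) : circ r (2 * PI) = circ r 0.
Proof. unfold circ. now rewrite cos_2PI, sin_2PI, cos_0, sin_0. Qed.

Lemma circ_minus_neq_0 (r t : R) (z : C) : Cmod z < r -> (circ r t - z <> 0)%C.
Proof.
  intros Hz E.
  assert (0 <= r) by (pose proof (Cmod_ge_0 z); lra).
  assert (K := Cmod_circ r t H).
  replace (circ r t) with (circ r t - z + z)%C in K by ring.
  rewrite E, Cplus_0_l in K. lra.
Qed.

Lemma two_PI_pos : 0 <= 2 * PI.
Proof. pose proof PI_RGT_0; lra. Qed.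

Definition cauchy_kernel (r : R) (c : R -> C) (m : nat) (t : R) (z : C) : C :=
  (c t * (/ (circ r t - z)) ^ m)%C.

(** On the circle, d zeta = i zeta dt. With [c t = f (circ r t) * circ r t] this is the contour
    integral of f(zeta)/(zeta - z)^m divided by i, hence the factor 2 pi instead of 2 pi i in
    Cauchy's formula. *)
Definition cauchy_int (r : R) (c : R -> C) (m : nat) (z : C) : C :=
  cint (fun t => cauchy_kernel r c m t z) 0 (2 * PI).

Lemma cauchy_kernel_ccont (r : R) (c : R -> C) (m : nat) (t : R) (z : C) :
  ccont c t -> Cmod z < r -> jointly_ccont (cauchy_kernel r c m) (t, z).
Proof.
  intros Hc Hz. unfold cauchy_kernel. apply ccont_mult.
  - now apply (ccont_fst c).
  - apply ccont_pow, ccont_inv.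
    + apply ccont_minus; [apply (ccont_fst (circ r)), ccont_circ | apply ccont_snd].
    + now apply circ_minus_neq_0.
Qed.

Lemma cauchy_kernel_ccont_l (r : R) (c : R -> C) (m : nat) (t : R) (z : C) :
  ccont c t -> Cmod z < r -> ccont (fun s => cauchy_kernel r c m s z) t.
Proof.
  intros Hc Hz. unfold cauchy_kernel. apply ccont_mult; [exact Hc |].
  apply ccont_pow, ccont_inv; [| now apply circ_minus_neq_0].
  apply ccont_minus; [apply ccont_circ | apply ccont_const].
Qed.

Lemma Cmod_near (z w : C) (r d : R) :
  Cmod z + d <= r -> Cmod (w - z) < d -> Cmod w < r.
Proof.
  intros H1 H2. replace w with (w - z + z)%C by ring.
  eapply Rle_lt_trans; [apply Cmod_triangle | lra].
Qed.

Lemma cder_cauchy_int (r : R) (c : R -> C) (m : nat) (z : C) :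
  (forall t, 0 <= t <= 2 * PI -> ccont c t) -> Cmod z < r ->
  cder (cauchy_int r c (S m)) z (INR (S m) * cauchy_int r c (S (S m)) z)%C.
Proof.
  intros Hc Hz. unfold cauchy_int.
  rewrite <- cint_scal.
  2:{ apply ex_cint_ccont; [apply two_PI_pos |]. intros t Ht. apply cauchy_kernel_ccont_l; auto. }
  apply (cder_cint_param (cauchy_kernel r c (S m))
    (fun t w => INR (S m) * cauchy_kernel r c (S (S m)) t w)%C 0 (2 * PI) z (r - Cmod z)).
  - apply two_PI_pos.
  - lra.
  - intros t w Ht Hw.
    assert (Hw' : Cmod w < r) by (apply (Cmod_near z w r (r - Cmod z)); lra).
    pose proof (circ_minus_neq_0 r t w Hw') as Hne.
    unfold cauchy_kernel.
    apply der_eq with (c t * (INR (S m) * (/ (circ r t - w)) ^ pred (S m) *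
       (- (0 - 1) / ((circ r t - w) * (circ r t - w)))))%C.
    + apply (der_scal _ w (ccont_id w)).
      apply (der_pow _ (fun w : C => / (circ r t - w))%C); [apply ccont_id |].
      apply (der_inv _ (fun w : C => circ r t - w)%C); [apply ccont_id | | exact Hne].
      apply (der_minus _ w (ccont_id w) (fun _ => circ r t) (fun w => w)); [apply der_const | apply der_self].
    + simpl Nat.pred. rewrite !Cpow_S. field. exact Hne.
  - intros t w Ht Hw. apply cauchy_kernel_ccont_l; [auto |].
    apply (Cmod_near z w r (r - Cmod z)); lra.
  - intros t Ht. apply (ccont_mult (fun _ => RtoC (INR (S m)))); [apply ccont_const |].
    apply cauchy_kernel_ccont; auto.
Qed.

Lemma der_zero_const (F : C -> C) (p d : C) :
  (forall t : R, 0 <= t <= 1 -> cder F (p + t * d)%C 0) -> F (p + d)%C = F p.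
Proof.
  intros H.
  assert (K : Cmod (F (p + 1%R * d)%C - F (p + 0%R * d)%C) <= 0 * (1 - 0)).
  { apply (rder_MVT (fun t : R => F (p + t * d)%C) (fun _ => RtoC 0)); [lra | |].
    - intros t Ht. apply der_eq with (d * 0)%C; [| ring]. now apply rder_line, H.
    - intros t Ht. rewrite Cmod_0. lra. }
  replace (p + 1 * d)%C with (p + d)%C in K by ring.
  replace (p + 0 * d)%C with p in K by ring.
  assert (E : (F (p + d)%C - F p)%C = 0).
  { apply Cmod_eq_0. pose proof (Cmod_ge_0 (F (p + d)%C - F p)). lra. }
  replace (F (p + d)%C) with (F (p + d)%C - F p + F p)%C by ring. rewrite E. ring.
Qed.

(** The integrand is the derivative in [t] of i/(zeta - z), which takes equal values at both ends of
    the closed circle. *)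
Lemma cauchy_int_circ_2 (r : R) (z : C) : Cmod z < r -> cauchy_int r (circ r) 2 z = 0.
Proof.
  intros Hz. unfold cauchy_int.
  rewrite (cint_FTC (fun t => Ci * / (circ r t - z))%C); [| apply two_PI_pos | |].
  - rewrite circ_periodic. ring.
  - intros t _. pose proof (circ_minus_neq_0 r t z Hz) as Hne.
    apply der_eq with (Ci * (- (Ci * circ r t - 0) / ((circ r t - z) * (circ r t - z))))%C.
    + apply (der_scal RtoC t (ccont_RtoC_id t)).
      apply (der_inv RtoC (fun t => circ r t - z)%C); [apply ccont_RtoC_id | | exact Hne].
      apply (der_minus RtoC t (ccont_RtoC_id t) (circ r) (fun _ => z)); [apply rder_circ | apply der_const].
    + unfold cauchy_kernel; simpl.
      assert (E : (Ci * Ci = - (1))%C) by (unfold Ci, Cmult, Copp, RtoC; simpl; f_equal; ring).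
      transitivity (- (Ci * Ci) * (circ r t / ((circ r t - z) * (circ r t - z))))%C;
        [field; exact Hne |].
      rewrite E. field. exact Hne.
  - intros t _. apply cauchy_kernel_ccont_l; [apply ccont_circ | exact Hz].
Qed.

(** The derivative in [z] is the vanishing integral of order 2, so the value is constant on the
    disk; at the centre the integrand is 1. *)
Lemma cauchy_int_circ_1 (r : R) (z : C) :
  Cmod z < r -> cauchy_int r (circ r) 1 z = RtoC (2 * PI).
Proof.
  intros Hz.
  assert (Hr : 0 < r) by (pose proof (Cmod_ge_0 z); lra).
  replace z with (0 + z)%C by ring.
  rewrite (der_zero_const (cauchy_int r (circ r) 1) 0 z).
  - unfold cauchy_int. rewrite (cint_ext _ (fun _ => RtoC 1)), cint_const; [| apply two_PI_pos |].
    + rewrite Rminus_0_r. ring.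
    + intros t _. unfold cauchy_kernel.
      assert (H0 : (circ r t - 0 <> 0)%C) by (apply circ_minus_neq_0; now rewrite Cmod_0).
      simpl. replace (circ r t - 0)%C with (circ r t) in * by ring. field. exact H0.
  - intros t Ht.
    assert (Cmod (0 + t * z) < r).
    { replace (0 + t * z)%C with (t * z)%C by ring.
      rewrite Cmod_mult, Cmod_R, Rabs_pos_eq by lra. pose proof (Cmod_ge_0 z). nra. }
    eapply der_eq.
    + apply cder_cauchy_int; [intros; apply ccont_circ | assumption].
    + rewrite cauchy_int_circ_2 by assumption. ring.
Qed.

(** Continuity of the derivative is built in because the homotopy proof of Cauchy's formula
    differentiates under the integral. For members of [class_K] it holds since [f1] is itself
    differentiable. *)
Definition holo (f f1 : C -> C) : Prop :=
  forall z, in_disk z -> cder f z (f1 z) /\ ccont f1 z.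

Section cauchy_formula.
Variables (f f1 : C -> C) (r : R) (z : C).
Hypotheses (Hf : holo f f1) (Hr : 0 < r < 1) (Hz : Cmod z < r).

(** The homotopy parameter is complex, although only values in [0, 1] matter, so that complex
    differentiation under the integral applies to it. *)
Let path (t : R) (s : C) : C := (z + s * (circ r t - z))%C.

(** For real [s0] in [0, 1] the path stays within radius [r] by convexity. As |circ r t - z| <= 2,
    moving the parameter by less than [(1 - r) / 2] moves the point by less than [1 - r]. *)
Lemma path_bound (t s0 : R) (s : C) :
  0 <= s0 <= 1 -> Cmod (s - s0) < (1 - r) / 2 -> Cmod (path t s) < 1.
Proof.
  intros Hs0 Hs. unfold path.
  replace (z + s * (circ r t - z))%C
    with ((1 - s0)%R * z + (s0 * circ r t + (s - s0) * (circ r t - z)))%C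
    by (rewrite RtoC_minus; ring).
  assert (K : Cmod (circ r t - z) <= 2).
  { eapply Rle_trans; [apply Cmod_triangle |]. rewrite Cmod_opp, Cmod_circ; lra. }
  eapply Rle_lt_trans; [apply Cmod_triangle |].
  eapply Rle_lt_trans; [apply Rplus_le_compat_l, Cmod_triangle |].
  rewrite !Cmod_mult, !Cmod_R, Cmod_circ, !Rabs_pos_eq by lra.
  pose proof (Cmod_ge_0 z). pose proof (Cmod_ge_0 (s - s0)).
  pose proof (Cmod_ge_0 (circ r t - z)). nra.
Qed.

Lemma path_bound0 (t s0 : R) : 0 <= s0 <= 1 -> Cmod (path t s0) < 1.
Proof.
  intros H. apply path_bound with s0; [exact H |].
  replace (s0 - s0)%C with (RtoC 0) by ring. rewrite Cmod_0. lra.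
Qed.

Lemma ccont_path_l (t : R) (s : C) : ccont (fun t => path t s) t.
Proof.
  unfold path. apply ccont_plus; [apply ccont_const |].
  apply ccont_mult; [apply ccont_const |].
  apply ccont_minus; [apply ccont_circ | apply ccont_const].
Qed.

(** In [t], f(path t s) has derivative i s zeta f1(path t s) with zeta = [circ r t], so f(path t
    s)/(i s) is a periodic primitive of the integrand. At s = 0 the path is the single point [z],
    and f1(z) zeta / i serves instead. *)
Lemma homotopy_derivative_zero (s : R) : 0 <= s <= 1 ->
  cint (fun t => f1 (path t s) * circ r t)%C 0 (2 * PI) = RtoC 0 :> C.
Proof.
  intros Hs.
  assert (Hc : forall t, ccont (fun t => f1 (path t s) * circ r t)%C t).
  { intros t. apply ccont_mult; [| apply ccont_circ].
    apply (ccont_comp (fun t => path t s) f1); [apply ccont_path_l |].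
    now apply Hf, path_bound0. }
  assert (Ci_neq : (Ci <> 0)%C) by (intros E; injection E; lra).
  destruct (Req_dec s 0) as [-> | Hs0].
  - rewrite (cint_FTC (fun t => f1 z / Ci * circ r t)%C); [| apply two_PI_pos | |].
    + rewrite circ_periodic. ring.
    + intros t _. apply der_eq with (f1 z / Ci * (Ci * circ r t))%C.
      * apply (der_scal RtoC t (ccont_RtoC_id t)), rder_circ.
      * unfold path. replace (z + 0 * (circ r t - z))%C with z by ring. field. exact Ci_neq.
    + intros t _. apply Hc.
  - assert (Hs' : (RtoC s <> 0)) by (intros E; now apply Hs0, RtoC_inj).
    rewrite (cint_FTC (fun t => / (Ci * s) * f (path t s))%C); [| apply two_PI_pos | |].
    + unfold path. rewrite circ_periodic. ring.
    + intros t _.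
      apply der_eq with (/ (Ci * s) * ((0 + s * (Ci * circ r t - 0)) * f1 (path t s)))%C.
      * apply (der_scal RtoC t (ccont_RtoC_id t)).
        apply (der_comp RtoC t (ccont_RtoC_id t) (fun t => path t s) f);
          [| now apply Hf, path_bound0].
        unfold path.
        apply (der_plus RtoC t (fun _ => z) (fun t => s * (circ r t - z))%C); [apply der_const |].
        apply (der_scal RtoC t (ccont_RtoC_id t) s (fun t => circ r t - z)%C).
        apply (der_minus RtoC t (ccont_RtoC_id t) (circ r) (fun _ => z)); [apply rder_circ | apply der_const].
      * field. split; [exact Hs' | exact Ci_neq].
    + intros t _. apply Hc.
Qed.

(* Contract the circle to [z]: the homotopy [s |-> z + s (zeta - z)] leaves the integral
   unchanged, since its [s]-derivative integrates an exact differential over a closed curve. *)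
Lemma cauchy_formula :
  cauchy_int r (fun t => f (circ r t) * circ r t)%C 1 z = (RtoC (2 * PI) * f z)%C.
Proof.
  pose (k := fun t => (circ r t / (circ r t - z))%C).
  assert (Hne : forall t, (circ r t - z <> 0)%C) by (intros; now apply circ_minus_neq_0).
  assert (Hk : forall t, ccont k t).
  { intros t. apply ccont_div; [apply ccont_circ | | apply Hne].
    apply ccont_minus; [apply ccont_circ | apply ccont_const]. }
  pose (Phi := fun s : C => cint (fun t => f (path t s) * k t)%C 0 (2 * PI)).
  assert (E : Phi (0 + 1)%C = Phi 0).
  { apply der_zero_const. intros s Hs.
    replace (0 + s * 1)%C with (RtoC s) by ring.
    rewrite <- (homotopy_derivative_zero s Hs).
    apply (cder_cint_param (fun t s => f (path t s) * k t)%C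
      (fun t s => f1 (path t s) * circ r t)%C 0 (2 * PI) s ((1 - r) / 2)).
    - apply two_PI_pos.
    - lra.
    - intros t w Ht Hw.
      apply der_eq with (((0 + (1 * (circ r t - z) + w * 0)) * f1 (path t w)) * k t + f (path t w) * 0)%C.
      + apply (der_mult _ w (ccont_id w) (fun w => f (path t w)) (fun _ => k t)); [| apply der_const].
        apply (der_comp _ w (ccont_id w) (path t) f); [| now apply Hf, path_bound with s].
        unfold path. apply (der_plus _ w (fun _ => z) (fun s => s * (circ r t - z))%C); [apply der_const |].
        apply (der_mult _ w (ccont_id w) (fun s => s) (fun _ => circ r t - z)%C);
          [apply der_self | apply der_const].
      + unfold k. field. apply Hne.
    - intros t w Ht Hw. apply ccont_mult; [| apply Hk].
      apply (ccont_comp (fun t => path t w) f); [apply ccont_path_l |].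
      eapply cder_ccont. now apply Hf, path_bound with s.
    - intros t Ht. apply ccont_mult; [| apply (ccont_fst (circ r)), ccont_circ].
      apply (ccont_comp (fun p : R * C => path (fst p) (snd p)) f1).
      + unfold path. apply ccont_plus; [apply ccont_const |].
        apply ccont_mult; [apply ccont_snd |].
        apply ccont_minus; [apply (ccont_fst (circ r)), ccont_circ | apply ccont_const].
      + now apply Hf, path_bound0. }
  transitivity (Phi (0 + 1)%C).
  - unfold Phi, cauchy_int. apply cint_ext; [apply two_PI_pos |]. intros t _.
    unfold cauchy_kernel, k, path.
    replace (z + (0 + 1) * (circ r t - z))%C with (circ r t) by ring. simpl. field. apply Hne.
  - rewrite E. rewrite Cmult_comm, <- (cauchy_int_circ_1 r z Hz). unfold Phi, cauchy_int.
    rewrite <- cint_scal.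
    + apply cint_ext; [apply two_PI_pos |]. intros t _. unfold cauchy_kernel, k, path.
      replace (z + 0 * (circ r t - z))%C with z by ring. simpl. field. apply Hne.
    + apply ex_cint_ccont; [apply two_PI_pos |]. intros t _.
      apply cauchy_kernel_ccont_l; [apply ccont_circ | exact Hz].
Qed.

End cauchy_formula.

(** * Derivatives of holomorphic functions *)

Lemma holo_ccont (f f1 : C -> C) (z : C) : holo f f1 -> in_disk z -> ccont f z.
Proof. intros H Hz. eapply cder_ccont. now apply H. Qed.

Lemma locally_disk (z : C) (r : R) : Cmod z < r -> locally z (fun w => Cmod w < r).
Proof.
  intros Hz. apply locally_C_intro with (r - Cmod z); [lra |].
  intros w Hw. apply (Cmod_near z w r (r - Cmod z)); lra.
Qed.

Lemma two_PI_neq_0 : RtoC (2 * PI) <> 0.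
Proof. intros E. apply RtoC_inj in E. pose proof PI_RGT_0. lra. Qed.

(** Cauchy's formula writes [f] inside each circle as an integral whose kernel can be differentiated
    repeatedly in [z]; the orders 2 and 3 of [cauchy_int] represent [f1] and its derivative. *)
Lemma holo_derivative (f f1 : C -> C) : holo f f1 -> exists f2, holo f1 f2.
Proof.
  intros Hf.
  pose (c := fun r t => (f (circ r t) * circ r t)%C).
  assert (Hc : forall r, 0 < r < 1 -> forall t, 0 <= t <= 2 * PI -> ccont (c r) t).
  { intros r Hr t _. apply ccont_mult; [| apply ccont_circ].
    apply (ccont_comp (circ r) f); [apply ccont_circ |].
    apply (holo_ccont f f1); [exact Hf |]. unfold in_disk. rewrite Cmod_circ; lra. }
  pose proof two_PI_neq_0 as Hpi.
  assert (H1 : forall r, 0 < r < 1 -> forall z, Cmod z < r ->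
     f1 z = (cauchy_int r (c r) 2 z / RtoC (2 * PI))%C).
  { intros r Hr z Hz.
    apply (cder_unique f z); [apply Hf; unfold in_disk; lra |].
    apply cder_ext_loc with (fun w => / RtoC (2 * PI) * cauchy_int r (c r) 1 w)%C.
    - generalize (locally_disk z r Hz). apply filter_imp. intros w Hw.
      unfold c. rewrite (cauchy_formula f f1 r w Hf Hr Hw). field. exact Hpi.
    - apply der_eq with (/ RtoC (2 * PI) * (INR 1 * cauchy_int r (c r) 2 z))%C.
      + apply (der_scal _ z (ccont_id z)). apply cder_cauchy_int; auto.
      + simpl INR. field. exact Hpi. }
  pose (f2 := fun r z => (/ RtoC (2 * PI) * (INR 2 * cauchy_int r (c r) 3 z))%C).
  assert (H2 : forall r, 0 < r < 1 -> forall z, Cmod z < r -> cder f1 z (f2 r z)).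
  { intros r Hr z Hz.
    apply cder_ext_loc with (fun w => / RtoC (2 * PI) * cauchy_int r (c r) 2 w)%C.
    - generalize (locally_disk z r Hz). apply filter_imp. intros w Hw.
      rewrite (H1 r Hr w Hw). field. exact Hpi.
    - apply (der_scal _ z (ccont_id z)). apply cder_cauchy_int; auto. }
  (* The radius has to exceed |z|, hence varies with [z]. Uniqueness of derivatives makes the value
     independent of the radius, so near [z] the function agrees with one of fixed radius, which is
     differentiable. *)
  exists (fun z => f2 ((1 + Cmod z) / 2) z). intros z Hz. unfold in_disk in Hz.
  pose proof (Cmod_ge_0 z) as Pz. split; [apply H2; lra |].
  apply ccont_ext_loc with (f2 ((1 + Cmod z) / 2)).
  - assert (Hz' : Cmod z < (1 + Cmod z) / 2) by lra.
    generalize (locally_disk z _ Hz'). apply filter_imp. intros w Hw.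
    pose proof (Cmod_ge_0 w).
    apply (cder_unique f1 w); apply H2; lra.
  - unfold f2. apply ccont_mult; [apply ccont_const |].
    apply ccont_mult; [apply ccont_const |].
    eapply cder_ccont. apply cder_cauchy_int; [apply Hc |]; lra.
Qed.

(** * Radial means *)

Lemma in_disk_scal (t : R) (z : C) : 0 <= t <= 1 -> in_disk z -> in_disk (t * z).
Proof.
  unfold in_disk. intros Ht Hz. rewrite Cmod_mult, Cmod_R, Rabs_pos_eq by lra.
  pose proof (Cmod_ge_0 z). nra.
Qed.

Lemma in_disk_near (z w : C) : Cmod (w - z) < 1 - Cmod z -> in_disk w.
Proof. intros H. apply (Cmod_near z w 1 (1 - Cmod z)); [lra | exact H]. Qed.

Lemma jointly_ccont_scal (h : C -> C) (t : R) (z : C) :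
  ccont h (t * z)%C -> jointly_ccont (fun (t : R) (z : C) => h (t * z)%C) (t, z).
Proof.
  intros H. apply (ccont_comp (fun p : R * C => fst p * snd p)%C h); [| exact H].
  apply ccont_mult; [apply (ccont_fst RtoC), ccont_RtoC_id | apply ccont_snd].
Qed.

Lemma ccont_scal_l (h : C -> C) (t : R) (z : C) :
  ccont h (t * z)%C -> ccont (fun s : R => h (s * z)%C) t.
Proof.
  intros H. apply (ccont_comp (fun s : R => s * z)%C h); [| exact H].
  apply ccont_mult; [apply ccont_RtoC_id | apply ccont_const].
Qed.

Lemma cder_scal_arg (h : C -> C) (t z l : C) :
  cder h (t * z)%C l -> cder (fun w => h (t * w)%C) z (t * l)%C.
Proof.
  intros H. apply (der_comp _ z (ccont_id z) (fun w => t * w)%C h); [| exact H].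
  apply der_eq with (t * 1)%C; [| ring].
  apply (der_scal _ z (ccont_id z) t (fun w => w)), der_self.
Qed.

Lemma rder_scal_arg (h : C -> C) (t : R) (z l : C) :
  cder h (t * z)%C l -> rder (fun s : R => h (s * z)%C) t (z * l)%C.
Proof.
  intros H. apply der_ext with (fun s : R => h (0 + s * z)%C).
  { intros s. f_equal. ring. }
  apply rder_line. now rewrite Cplus_0_l.
Qed.

(** For [m = 0] and h = f' with f(0) = 0 this is f(z)/z with the value at 0 filled in; its m-th
    derivative is [radial m] of the derivative of [f] of order m + 1. *)
Definition radial (m : nat) (h : C -> C) (z : C) : C :=
  cint (fun t : R => (t ^ m * h (t * z))%C) 0 1.

Lemma cder_radial (m : nat) (h h1 : C -> C) (z : C) :
  holo h h1 -> in_disk z -> cder (radial m h) z (radial (S m) h1 z).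
Proof.
  intros Hh Hz.
  apply (cder_cint_param (fun (t : R) z => t ^ m * h (t * z))%C
    (fun (t : R) z => t ^ S m * h1 (t * z))%C 0 1 z (1 - Cmod z)).
  - lra.
  - unfold in_disk in Hz; lra.
  - intros t w Ht Hw.
    apply der_eq with (t ^ m * (t * h1 (t * w)))%C; [| rewrite Cpow_S; ring].
    apply (der_scal _ w (ccont_id w) (t ^ m)%C (fun w => h (t * w)%C)).
    apply cder_scal_arg, Hh, in_disk_scal; [exact Ht | now apply in_disk_near with z].
  - intros t w Ht Hw. apply ccont_mult; [apply ccont_pow, ccont_RtoC_id |].
    apply ccont_scal_l. apply (holo_ccont h h1); [exact Hh |].
    apply in_disk_scal; [exact Ht | now apply in_disk_near with z].
  - intros t Ht. apply ccont_mult; [apply ccont_pow, (ccont_fst RtoC), ccont_RtoC_id |].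
    apply jointly_ccont_scal. now apply Hh, in_disk_scal.
Qed.

Lemma holo_radial (m : nat) (h h1 : C -> C) :
  holo h h1 -> holo (radial m h) (radial (S m) h1).
Proof.
  intros Hh z Hz. split; [now apply cder_radial |].
  destruct (holo_derivative h h1 Hh) as [h2 H2].
  eapply cder_ccont. now apply (cder_radial _ h1 h2).
Qed.

Lemma radial_0 (h h1 : C -> C) (z : C) :
  holo h h1 -> in_disk z -> (z * radial 0 h1 z)%C = (h z - h 0)%C.
Proof.
  intros Hh Hz.
  assert (Hc : forall t, 0 <= t <= 1 -> ccont (fun t : R => (t ^ 0 * h1 (t * z))%C) t).
  { intros t Ht. apply ccont_mult; [apply ccont_pow, ccont_RtoC_id |].
    apply ccont_scal_l. now apply Hh, in_disk_scal. }
  unfold radial. rewrite <- cint_scal by (apply ex_cint_ccont; [lra | exact Hc]).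
  rewrite (cint_FTC (fun t : R => h (t * z)%C)).
  - now rewrite Cmult_1_l, Cmult_0_l.
  - lra.
  - intros t Ht. apply der_eq with (z * h1 (t * z))%C; [| simpl; ring].
    now apply rder_scal_arg, Hh, in_disk_scal.
  - intros t Ht. apply ccont_mult; [apply ccont_const | now apply Hc].
Qed.

(** Differentiating the integrand in [z] gives h(tz) + t z h1(tz), which is the derivative of t
    h(tz) in [t] and so integrates to h(z). *)
Lemma cder_primitive (h h1 : C -> C) (z : C) :
  holo h h1 -> in_disk z -> cder (fun w => cint (fun t : R => w * h (t * w))%C 0 1) z (h z).
Proof.
  intros Hh Hz.
  replace (h z) with (cint (fun t : R => 1 * h (t * z) + z * (t * h1 (t * z)))%C 0 1).
  - apply (cder_cint_param (fun (t : R) w => w * h (t * w))%C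
      (fun (t : R) w => 1 * h (t * w) + w * (t * h1 (t * w)))%C 0 1 z (1 - Cmod z)).
    + lra.
    + unfold in_disk in Hz; lra.
    + intros t w Ht Hw.
      apply (der_mult _ w (ccont_id w) (fun w => w) (fun w => h (t * w)%C)); [apply der_self |].
      apply cder_scal_arg, Hh, in_disk_scal; [exact Ht | now apply in_disk_near with z].
    + intros t w Ht Hw. apply ccont_mult; [apply ccont_const |].
      apply ccont_scal_l. apply (holo_ccont h h1); [exact Hh |].
      apply in_disk_scal; [exact Ht | now apply in_disk_near with z].
    + intros t Ht. apply ccont_plus.
      * apply ccont_mult; [apply ccont_const |].
        apply jointly_ccont_scal. apply (holo_ccont h h1); [exact Hh | now apply in_disk_scal].
      * apply ccont_mult; [apply ccont_snd |].
        apply ccont_mult; [apply (ccont_fst RtoC), ccont_RtoC_id |].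
        apply jointly_ccont_scal. now apply Hh, in_disk_scal.
  - rewrite (cint_FTC (fun t : R => t * h (t * z))%C).
    + rewrite Cmult_0_l, !Cmult_1_l. unfold Cminus. rewrite Copp_0. apply Cplus_0_r.
    + lra.
    + intros t Ht.
      apply der_eq with (1 * h (t * z) + t * (z * h1 (t * z)))%C; [| ring].
      apply (der_mult RtoC t (ccont_RtoC_id t) RtoC (fun t : R => h (t * z)%C)); [apply der_self |].
      now apply rder_scal_arg, Hh, in_disk_scal.
    + intros t Ht. apply ccont_plus.
      * apply ccont_mult; [apply ccont_const |].
        apply ccont_scal_l. apply (holo_ccont h h1); [exact Hh | now apply in_disk_scal].
      * apply ccont_mult; [apply ccont_const |].
        apply ccont_mult; [apply ccont_RtoC_id |].
        apply ccont_scal_l. now apply Hh, in_disk_scal.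
Qed.

(** * The maximum principle and Jack's lemma *)

Lemma holo_pow (g g1 : C -> C) (n : nat) :
  holo g g1 -> holo (fun z => g z ^ n)%C (fun z => INR n * g z ^ pred n * g1 z)%C.
Proof.
  intros H z Hz. split.
  - apply (der_pow _ g); [apply ccont_id | now apply H].
  - apply ccont_mult; [| now apply H]. apply ccont_mult; [apply ccont_const |].
    apply ccont_pow. now apply (holo_ccont g g1).
Qed.

(* Landau's trick: apply Cauchy's formula to [g ^ n] and let [n] tend to infinity. *)
Lemma maximum_principle (g g1 : C -> C) (r M : R) (z : C) :
  holo g g1 -> 0 < r < 1 -> Cmod z < r ->
  (forall t, 0 <= t <= 2 * PI -> Cmod (g (circ r t)) <= M) -> Cmod (g z) <= M.
Proof.
  intros Hg Hr Hz HM.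
  pose proof PI_RGT_0 as Hpi.
  assert (M0 : 0 <= M).
  { apply Rle_trans with (2 := HM 0 ltac:(lra)). apply Cmod_ge_0. }
  (* A bound for |zeta/(zeta - z)| on the circle, independent of the exponent [n]. *)
  pose (A := r / (r - Cmod z)).
  assert (HA : 0 <= A) by (apply Rdiv_le_0_compat; lra).
  assert (Hn : forall n, Cmod (g z) ^ n <= A * M ^ n).
  { intros n.
    assert (E := cauchy_formula _ _ r z (holo_pow g g1 n Hg) Hr Hz). cbv beta in E.
    apply (f_equal Cmod) in E.
    rewrite Cmod_mult, Cmod_R, Cmod_pow, Rabs_pos_eq in E by lra.
    apply Rmult_le_reg_l with (2 * PI); [lra |]. rewrite <- E.
    unfold cauchy_int. replace (2 * PI * (A * M ^ n)) with ((2 * PI - 0) * (A * M ^ n)) by ring.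
    assert (Cc : forall t, ccont (fun t => g (circ r t) ^ n * circ r t)%C t).
    { intros t. apply ccont_mult; [| apply ccont_circ]. apply ccont_pow.
      apply (ccont_comp (circ r) g); [apply ccont_circ |].
      apply (holo_ccont g g1); [exact Hg |]. unfold in_disk. rewrite Cmod_circ; lra. }
    apply cint_le; [lra | |].
    - apply ex_cint_ccont; [lra |]. intros t _. now apply cauchy_kernel_ccont_l.
    - intros t Ht. unfold cauchy_kernel.
      assert (K : r - Cmod z <= Cmod (circ r t - z)).
      { assert (K := Cmod_triangle (circ r t - z) z).
        replace (circ r t - z + z)%C with (circ r t) in K by ring.
        rewrite Cmod_circ in K; lra. }
      rewrite !Cmod_mult, !Cmod_pow, Cmod_circ, pow_1, Cmod_inv by (lra || now apply circ_minus_neq_0).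
      replace (A * M ^ n) with (M ^ n * r * / (r - Cmod z)) by (unfold A; field; lra).
      apply Rmult_le_compat.
      + apply Rmult_le_pos; [apply pow_le, Cmod_ge_0 | lra].
      + left. apply Rinv_0_lt_compat. lra.
      + apply Rmult_le_compat_r; [lra |]. apply pow_incr.
        split; [apply Cmod_ge_0 | now apply HM].
      + apply Rinv_le_contravar; lra. }
  destruct (Rle_or_lt (Cmod (g z)) M) as [H | H]; [exact H | exfalso].
  (* For [M = 0] the exponent 1 suffices. Otherwise the powers of |g z|/M, a ratio above 1, would
     all stay below [A]. *)
  destruct (Req_dec M 0) as [-> | HM0].
  { specialize (Hn 1%nat). simpl in Hn. lra. }
  assert (HMp : 0 < M) by lra.
  assert (Hx : Rabs (Cmod (g z) / M) > 1).
  { rewrite Rabs_pos_eq by (apply Rdiv_le_0_compat; lra). apply Rlt_div_r; lra. }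
  destruct (Pow_x_infinity _ Hx (A + 1)) as [N HN].
  specialize (HN N (le_n N)).
  assert (Hp : 0 < M ^ N) by now apply pow_lt.
  rewrite Rabs_pos_eq in HN by (apply pow_le, Rdiv_le_0_compat; lra).
  unfold Rdiv in HN. rewrite Rpow_mult_distr, pow_inv in HN.
  specialize (Hn N).
  assert (Cmod (g z) ^ N * / M ^ N <= A); [| lra].
  apply Rle_div_l; assumption.
Qed.

(* Along a ray [z0 + t z0 eta] with [Re eta < 0], which enters the disk, the modulus
   cannot increase; hence [Re (u eta) <= 0] on the whole half-plane. *)
Lemma boundary_max_log_derivative (g : C -> C) (z0 l : C) :
  cder g z0 l -> z0 <> 0 -> g z0 <> 0 ->
  (forall z, Cmod z < Cmod z0 -> Cmod (g z) <= Cmod (g z0)) ->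
  let u := (z0 * l / g z0)%C in Im u = 0 /\ 0 <= Re u.
Proof.
  intros Hd Hz0 Hg0 Hmax u.
  assert (Hz0' : 0 < Cmod z0) by now apply Cmod_gt_0.
  assert (Hg0' : 0 < Cmod (g z0)) by now apply Cmod_gt_0.
  assert (Hray : forall eta : C, Re eta < 0 -> Re (u * eta)%C <= 0).
  { intros eta Heta.
    destruct (Rle_or_lt (Re (u * eta)%C) 0) as [H | Hc]; [exact H | exfalso].
    set (c := Re (u * eta)%C) in *.
    assert (Hray : rder (fun t : R => g (z0 + t * (z0 * eta))%C) 0 (z0 * eta * l)%C).
    { apply rder_line. replace (z0 + 0 * (z0 * eta))%C with z0 by ring. exact Hd. }
    (* To first order the real part of g/g(z0) grows by [t * c] along the ray. An error of at most
       half of that still pushes it above 1, against maximality. *)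
    assert (He : 0 < c / 2 * Cmod (g z0)) by (apply Rmult_lt_0_compat; lra).
    destruct (der_little_o _ _ _ _ Hray _ He) as [d Hd'].
    (* |1 + t eta|^2 < 1 amounts to t |eta|^2 < -2 Re eta for t > 0, which [t < m] ensures; the
       summand 1 keeps the divisor positive. *)
    pose (m := - 2 * Re eta / (Cmod eta ^ 2 + 1)).
    assert (Hm2 : 0 < Cmod eta ^ 2 + 1) by (pose proof (pow2_ge_0 (Cmod eta)); lra).
    assert (Hm : 0 < m) by (apply Rdiv_lt_0_compat; lra).
    pose (t := Rmin (d / 2) (m / 2)).
    pose proof (cond_pos d) as Pd.
    assert (Ht : 0 < t) by (apply Rmin_glb_lt; lra).
    assert (Ht1 : t <= d / 2) by apply Rmin_l.
    assert (Ht2 : t <= m / 2) by apply Rmin_r.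
    assert (Hball : ball 0 d t).
    { unfold ball; simpl; unfold AbsRing_ball, abs, minus, plus, opp; simpl.
      rewrite Ropp_0, Rplus_0_r, Rabs_pos_eq; lra. }
    specialize (Hd' t Hball). cbv beta in Hd'.
    rewrite <- RtoC_minus, Rminus_0_r, Cmod_R, Rabs_pos_eq in Hd' by lra.
    replace (z0 + 0 * (z0 * eta))%C with z0 in Hd' by ring.
    assert (Hin : Cmod (z0 + t * (z0 * eta)) < Cmod z0).
    { replace (z0 + t * (z0 * eta))%C with (z0 * (1 + t * eta))%C by ring.
      rewrite Cmod_mult. rewrite <- (Rmult_1_r (Cmod z0)) at 2.
      apply Rmult_lt_compat_l; [exact Hz0' |].
      assert (Hsq : Cmod (1 + t * eta) ^ 2 < 1).
      { rewrite Cmod2_alt in *.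
        assert (E : m * (Re eta ^ 2 + Im eta ^ 2 + 1) = - 2 * Re eta)
          by (unfold m; rewrite Cmod2_alt in *; field; lra).
        clearbody m t. destruct eta as [x y].
        unfold Re, Im, Cplus, Cmult, RtoC in *; simpl in *.
        assert (t * (x * (x * 1) + y * (y * 1) + 1) < - 2 * x) by nra.
        assert (t * (t * (x * (x * 1) + y * (y * 1) + 1)) < t * (- 2 * x)) by nra.
        nra. }
      pose proof (Cmod_ge_0 (1 + t * eta)). nra. }
    specialize (Hmax _ Hin).
    set (G := g (z0 + t * (z0 * eta))%C) in *.
    assert (K : Cmod (G / g z0 - 1 - t * (u * eta)) <= c / 2 * t).
    { replace (G / g z0 - 1 - t * (u * eta))%C
        with ((G - g z0 - t * (z0 * eta * l)) / g z0)%C by (unfold u; field; assumption).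
      rewrite Cmod_div by assumption. apply Rle_div_l; [exact Hg0' |].
      eapply Rle_trans; [exact Hd' |]. right; ring. }
    assert (K1 : Cmod (G / g z0) <= 1).
    { rewrite Cmod_div by assumption. apply Rle_div_l; lra. }
    pose proof (Rle_trans _ _ _ (re_le_Cmod _) K) as K'.
    pose proof (Rle_trans _ _ _ (re_le_Cmod _) K1) as K1'.
    apply Rabs_le_between in K'. apply Rabs_le_between in K1'.
    assert (E : Re (G / g z0 - 1 - t * (u * eta))%C = Re (G / g z0)%C - 1 - t * c).
    { unfold c. unfold Cminus. generalize (G / g z0)%C (u * eta)%C. intros [x1 y1] [x2 y2].
      unfold Re, Cplus, Copp, Cmult, RtoC; simpl. ring. }
    rewrite E in K'. assert (0 < c * t) by now apply Rmult_lt_0_compat. lra. }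
  (* Directions eta = -1 + i s: an affine function of [s] bounded above on the whole line has slope
     0, and [s = 0] then gives the sign of Re u. *)
  assert (Hs : forall s, - Re u - Im u * s <= 0).
  { intros s. specialize (Hray (-1, s)). unfold Re, Im, Cmult in *; simpl in *. lra. }
  assert (Hi : Im u = 0).
  { destruct (Req_dec (Im u) 0) as [E | E]; [exact E | exfalso].
    specialize (Hs (- (Re u + 1) / Im u)).
    replace (- Re u - Im u * (- (Re u + 1) / Im u)) with 1 in Hs by (field; assumption). lra. }
  split; [exact Hi |]. specialize (Hs 0). lra.
Qed.

Lemma circle_max (g g1 : C -> C) (r : R) :
  holo g g1 -> 0 < r < 1 ->
  exists t0, forall t, 0 <= t <= 2 * PI -> Cmod (g (circ r t)) <= Cmod (g (circ r t0)).
Proof.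
  intros Hg Hr.
  destruct (continuity_ab_maj (fun t => Cmod (g (circ r t))) 0 (2 * PI) two_PI_pos) as [t0 [H _]].
  - intros t _. apply continuity_pt_filterlim.
    apply (ccont_Cmod (fun t => g (circ r t))).
    apply (ccont_comp (circ r) g); [apply ccont_circ |].
    apply (holo_ccont g g1); [exact Hg |]. unfold in_disk. rewrite Cmod_circ; lra.
  - now exists t0.
Qed.

(** * The Marx-Strohhacker theorem *)

(** The equation is X = (1 + kW)/(1 - W) cleared of its denominator, so that [W = 1] is covered.
    With a = Re W it gives |1 - W|^2 Re X = 1 + (k - 1) a - k |W|^2, and a <= |W|^2 bounds this by 1
    - |W|^2 <= 0. Hence Re X > 0 forces W = 1, where the equation reads -k = 1. *)
Lemma jack_contradiction (W X : C) (k : R) :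
  1 <= Cmod W -> 1 <= k -> 0 < Re X -> ((1 - W) * X - k * W)%C = 1 -> False.
Proof.
  intros HW Hk HX E.
  assert (HW2 : 1 <= Re W ^ 2 + Im W ^ 2) by (rewrite <- Cmod2_alt; nra).
  destruct W as [a b], X as [x y]. unfold Re, Im, Cminus, Cplus, Copp, Cmult, RtoC in *; simpl in *.
  injection E as E1 E2.
  assert (P1 : (1 - a) * x + b * y = 1 + k * a) by lra.
  assert (P2 : (1 - a) * y - b * x = k * b) by lra.
  assert (E3 : ((1 - a) * (1 - a) + b * b) * x = 1 + (k - 1) * a - k * (a * a + b * b)).
  { transitivity ((1 - a) * ((1 - a) * x + b * y) - b * ((1 - a) * y - b * x)); [ring |].
    rewrite P1, P2. ring. }
  assert (HaS : a <= a * a + b * b) by nra.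
  assert (E4 : ((1 - a) * (1 - a) + b * b) * x <= 0) by (rewrite E3; nra).
  assert (E5 : (1 - a) * (1 - a) + b * b <= 0) by nra.
  assert (a = 1) by nra. assert (b = 0) by nra. subst. lra.
Qed.

(** |1 - v| < 1 means |v|^2 < 2 Re v, and Re (1/v) = Re v / |v|^2. It serves both for v = 1 - w and
    for v = 1 - z. *)
Lemma Re_inv_gt_half (v : C) : Cmod (1 - v) < 1 -> v <> 0 /\ / 2 < Re (/ v)%C.
Proof.
  intros H.
  assert (H2 : Re (1 - v)%C ^ 2 + Im (1 - v)%C ^ 2 < 1).
  { rewrite <- Cmod2_alt. pose proof (Cmod_ge_0 (1 - v)). nra. }
  destruct v as [x y]. unfold Re, Im, Cminus, Cplus, Copp, RtoC, Cinv in *; simpl in *.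
  assert (Hx : x * x + y * y < 2 * x) by lra.
  split.
  - intros E. injection E as -> ->. lra.
  - assert (0 < x * x + y * y) by nra.
    apply Rlt_div_r; [lra |]. lra.
Qed.

Lemma marx_strohhacker (f f1 f2 : C -> C) :
  holo f f1 -> holo f1 f2 -> f 0 = 0 ->
  (forall z, in_disk z -> f1 z <> 0 /\ 0 < Re (1 + z * f2 z / f1 z)%C) ->
  exists q q1 : C -> C, holo q q1 /\ forall z, in_disk z ->
    f z = (z * q z)%C /\ f1 z = (q z + z * q1 z)%C /\ q z <> 0 /\ / 2 < Re (f1 z / q z)%C.
Proof.
  intros Hf Hf1 Hf0 Hconv.
  destruct (holo_derivative _ _ Hf1) as [f3 Hf2].
  pose (q := radial 0 f1). pose (q1 := radial 1 f2). pose (q2 := radial 2 f3).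
  assert (Hq : holo q q1) by now apply holo_radial.
  assert (Hq1 : holo q1 q2) by now apply holo_radial.
  assert (Ef : forall z, in_disk z -> f z = (z * q z)%C).
  { intros z Hz. unfold q. rewrite (radial_0 f f1 z Hf Hz), Hf0. ring. }
  assert (Ef1 : forall z, in_disk z -> f1 z = (q z + z * q1 z)%C).
  { intros z Hz. apply (cder_unique f z); [now apply Hf |].
    apply cder_ext_loc with (fun w => w * q w)%C.
    - generalize (locally_disk z 1 Hz). apply filter_imp. intros w Hw. symmetry. now apply Ef.
    - apply der_eq with (1 * q z + z * q1 z)%C; [| ring].
      apply (der_mult _ z (ccont_id z) (fun w => w) q); [apply der_self | now apply Hq]. }
  assert (Ef2 : forall z, in_disk z -> f2 z = (q1 z + q1 z + z * q2 z)%C).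
  { intros z Hz. apply (cder_unique f1 z); [now apply Hf1 |].
    apply cder_ext_loc with (fun w => q w + w * q1 w)%C.
    - generalize (locally_disk z 1 Hz). apply filter_imp. intros w Hw. symmetry. now apply Ef1.
    - apply der_eq with (q1 z + (1 * q1 z + z * q2 z))%C; [| ring].
      apply (der_plus _ z q (fun w => w * q1 w)%C); [now apply Hq |].
      apply (der_mult _ z (ccont_id z) (fun w => w) q1); [apply der_self | now apply Hq1]. }
  (* Since f1 - q = z q1, this is w(z)/z. Its modulus peaks on a circle where that of [w] does, and
     z w'/w = 1 + z g'/g, so Jack's bound k >= 1 reduces to z g'/g >= 0 at the peak. *)
  pose (g := fun z => (q1 z / f1 z)%C).
  pose (g1 := fun z => ((q2 z * f1 z - q1 z * f2 z) / (f1 z * f1 z))%C).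
  assert (Hg : holo g g1).
  { intros z Hz. destruct (Hconv z Hz) as [Hne _]. split.
    - apply (der_div _ q1 f1); [apply ccont_id | now apply Hq1 | now apply Hf1 | exact Hne].
    - assert (Cf1 : ccont f1 z) by now apply Hf.
      apply ccont_div; [| now apply ccont_mult | now apply Cmult_neq_0].
      apply ccont_minus; apply ccont_mult; try assumption.
      + now apply Hq1.
      + now apply Hq.
      + now apply Hf1. }
  (* [w(z) = z g(z) = 1 - q(z) / f1(z)] is the Schwarz function of [z f' / f = 1 / (1 - w)]. *)
  assert (Hw : forall z, in_disk z -> Cmod (z * g z) < 1).
  { intros z Hz. unfold in_disk in Hz.
    pose proof (Cmod_ge_0 z) as Pz.
    pose (r := (1 + Cmod z) / 2).
    assert (Hr : 0 < r < 1) by (unfold r; lra).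
    assert (Hzr : Cmod z < r) by (unfold r; lra).
    destruct (circle_max g g1 r Hg Hr) as [t0 Hmax].
    set (z0 := circ r t0) in *.
    assert (Hz0r : Cmod z0 = r) by (apply Cmod_circ; lra).
    assert (Hin0 : in_disk z0) by (unfold in_disk; lra).
    assert (Hmax' : forall z, Cmod z < Cmod z0 -> Cmod (g z) <= Cmod (g z0)).
    { intros w Hwr. rewrite Hz0r in Hwr. now apply (maximum_principle g g1 r). }
    (* If |w(z0)| < 1, the maximum principle for [g] gives |z g(z)| <= r |g(z0)| = |w(z0)| < 1, as
       wanted. *)
    destruct (Rlt_or_le (Cmod (z0 * g z0)) 1) as [HW | HW].
    { rewrite Cmod_mult in *. rewrite Hz0r in *.
      specialize (Hmax' z Hzr). pose proof (Cmod_ge_0 (g z)). nra. }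
    exfalso.
    assert (Hz0 : z0 <> 0) by (apply Cmod_gt_0; lra).
    assert (Hg0 : g z0 <> 0).
    { intros E. rewrite E, Cmult_0_r, Cmod_0 in HW. lra. }
    destruct (boundary_max_log_derivative g z0 (g1 z0)) as [Hi Hre];
      [now apply Hg | exact Hz0 | exact Hg0 | exact Hmax' |].
    set (u := (z0 * g1 z0 / g z0)%C) in *.
    assert (Eu : u = RtoC (Re u)) by (rewrite (C_Re_Im u) at 1; rewrite Hi; ring).
    destruct (Hconv z0 Hin0) as [Hne HX].
    (* The required identity is the logarithmic derivative of 1 - w = f/(z f'), cleared of
       denominators, with k w(z0) = z0 w'(z0) for k = 1 + Re u. *)
    apply (jack_contradiction (z0 * g z0) (1 + z0 * f2 z0 / f1 z0) (1 + Re u));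
      [exact HW | lra | exact HX |].
    rewrite RtoC_plus, <- Eu.
    assert (Ek : ((1 + u) * (z0 * g z0) = z0 * g z0 + z0 * z0 * g1 z0)%C)
      by (unfold u; field; exact Hg0).
    rewrite Ek. unfold g, g1.
    assert (E2 : (z0 * q2 z0 = f2 z0 - q1 z0 - q1 z0)%C) by (rewrite (Ef2 z0 Hin0); ring).
    transitivity (1 + (z0 * f2 z0 - z0 * q1 z0 - z0 * q1 z0 - z0 * (z0 * q2 z0)) / f1 z0)%C.
    - field. exact Hne.
    - rewrite E2. field. exact Hne. }
  exists q, q1. split; [exact Hq |]. intros z Hz.
  destruct (Hconv z Hz) as [Hne _].
  split; [now apply Ef | split; [now apply Ef1 |]].
  destruct (Re_inv_gt_half (q z / f1 z)) as [H1 H2].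
  { replace (1 - q z / f1 z)%C with (z * g z)%C; [now apply Hw |].
    assert (E : (z * q1 z = f1 z - q z)%C) by (rewrite (Ef1 z Hz); ring).
    unfold g. transitivity (z * q1 z / f1 z)%C; [field; exact Hne |].
    rewrite E. field. exact Hne. }
  assert (Hq0 : q z <> 0).
  { intros E. apply H1. rewrite E. field. exact Hne. }
  split; [exact Hq0 |].
  replace (f1 z / q z)%C with (/ (q z / f1 z))%C; [exact H2 |].
  field. now split.
Qed.

(** * The principal branch of the power function *)

Lemma cexp_plus (z w : C) : cexp (z + w) = (cexp z * cexp w)%C.
Proof.
  destruct z as [x y], w as [x' y']. unfold cexp, Cmult, Cplus, Re, Im; simpl.
  rewrite exp_plus, cos_plus, sin_plus. f_equal; ring.
Qed.

Lemma cexp_0 : cexp 0 = 1.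
Proof.
  unfold cexp, RtoC, Re, Im; simpl. rewrite exp_0, cos_0, sin_0. f_equal; ring.
Qed.

Lemma cexp_neq_0 (z : C) : cexp z <> 0.
Proof.
  intros E. assert (K := cexp_plus z (- z)).
  rewrite E, Cplus_opp_r, cexp_0, Cmult_0_l in K. injection K; lra.
Qed.

Lemma cexp_polar (z : C) : cexp z = (RtoC (exp (Re z)) * circ 1 (Im z))%C.
Proof. unfold cexp, circ, RtoC, Cmult; simpl. f_equal; ring. Qed.

Lemma im_le_Cmod (z : C) : Rabs (Im z) <= Cmod z.
Proof. eapply Rle_trans; [apply Rmax_r | apply Rmax_Cmod]. Qed.

(** Write exp(x + iy) as e^x times e^(iy), with slopes [p] and [s] at 0 whose values there are 1 and
    i. The linearization error is x (p - 1) + y (s - i) + x y p s, and each term is at most a third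
    of eps |w| near 0. *)
Lemma cder_cexp_0 : cder cexp (RtoC 0) 1.
Proof.
  assert (He : rder (fun x => RtoC (exp x)) 0 1).
  { apply rder_RtoC. rewrite <- exp_0. apply is_derive_exp. }
  destruct He as [p [Hp1 [Hp2 Hp3]]]. destruct (rder_circ 1 0) as [s [Hs1 [Hs2 Hs3]]].
  assert (Ec : circ 1 0 = 1) by (unfold circ, RtoC; rewrite cos_0, sin_0; f_equal; ring).
  rewrite Ec, Cmult_1_r in Hs2.
  assert (CRe : ccont (fun w : C => p (Re w)) (RtoC 0)).
  { apply (ccont_comp_R (U := C_UniformSpace) Re p); [| exact Hp3].
    apply (ccont_Re (fun w : C => w)), ccont_id. }
  assert (CIm : ccont (fun w : C => s (Im w)) (RtoC 0)).
  { apply (ccont_comp_R (U := C_UniformSpace) Im s); [| exact Hs3].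
    apply (ccont_Im (fun w : C => w)), ccont_id. }
  assert (CIm' : ccont (fun w : C => RtoC (Im w)) (RtoC 0)).
  { apply ccont_RtoC, (ccont_Im (fun w : C => w)), ccont_id. }
  assert (CD := ccont_mult _ _ _ CIm' (ccont_mult _ _ _ CRe CIm)).
  apply der_of_little_o; [auto |]. intros e H.
  assert (He3 : 0 < e / 3) by lra.
  generalize (filter_and _ _ (CRe _ He3) (filter_and _ _ (CIm _ He3) (CD _ He3))).
  apply filter_imp. intros w [H1 [H2 H3]].
  unfold Re at 2 in H1. unfold Im at 2 in H2. unfold Im at 3 in H3. simpl in H1, H2, H3.
  rewrite Hp2 in H1. rewrite Hs2 in H2. rewrite Cmult_0_l in H3.
  replace (Im w * (p (Re w) * s (Im w)) - 0)%C with (Im w * (p (Re w) * s (Im w)))%C in H3 by ring.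
  rewrite cexp_0, cexp_polar, (Hp1 (Re w)), (Hs1 (Im w)), Ec, exp_0.
  assert (Ew : (w - 0 = Re w + Ci * Im w)%C) 
    by (rewrite <- C_Re_Im; unfold Cminus; rewrite Copp_0; apply Cplus_0_r).
  replace (Cmod (w - 0)) with (Cmod w) by (rewrite Ew, <- C_Re_Im; reflexivity).
  rewrite Ew.
  replace ((1 + (Re w - 0) * p (Re w)) * (1 + (Im w - 0) * s (Im w)) - 1
           - (Re w + Ci * Im w) * 1)%C
    with (Re w * (p (Re w) - 1) + (Im w * (s (Im w) - Ci)
           + Re w * (Im w * (p (Re w) * s (Im w)))))%C by ring.
  eapply Rle_trans; [apply Cmod_triangle |].
  eapply Rle_trans; [apply Rplus_le_compat_l, Cmod_triangle |].
  rewrite !(Cmod_mult (RtoC (Re w))), (Cmod_mult _ (s (Im w) - Ci)), !Cmod_R.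
  pose proof (re_le_Cmod w). pose proof (im_le_Cmod w).
  pose proof (Rabs_pos (Re w)). pose proof (Rabs_pos (Im w)).
  pose proof (Cmod_ge_0 (p (Re w) - 1)). pose proof (Cmod_ge_0 (s (Im w) - Ci)).
  pose proof (Cmod_ge_0 (Im w * (p (Re w) * s (Im w)))).
  apply Rle_trans with (Cmod w * (e / 3) + (Cmod w * (e / 3) + Cmod w * (e / 3))).
  - repeat apply Rplus_le_compat; apply Rmult_le_compat; lra.
  - right; field.
Qed.

Lemma cder_cexp (z : C) : cder cexp z (cexp z).
Proof.
  apply der_ext with (fun w => cexp z * cexp (w - z))%C.
  { intros w. rewrite <- cexp_plus. f_equal. ring. }
  apply der_eq with (cexp z * ((1 - 0) * 1))%C; [| ring].
  apply (der_scal _ z (ccont_id z) (cexp z) (fun w => cexp (w - z))).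
  apply (der_comp _ z (ccont_id z) (fun w => w - z)%C cexp).
  - apply (der_minus _ z (ccont_id z) (fun w => w) (fun _ => z)); [apply der_self | apply der_const].
  - replace (z - z)%C with (RtoC 0) by ring. apply cder_cexp_0.
Qed.

(** The logarithm is only ever differentiated on the right half-plane, which contains 1 - z for [z]
    in the disk and where the argument is a single arctangent. *)
Lemma plog_right (z : C) : 0 < Re z -> plog z = (ln (Cmod z), atan (Im z / Re z)).
Proof.
  intros H. unfold plog, parg. destruct (Rlt_dec 0 (Re z)); [reflexivity | contradiction].
Qed.

Lemma cexp_plog (z : C) : 0 < Re z -> cexp (plog z) = z.
Proof.
  intros H.
  assert (Hm : 0 < Cmod z).
  { pose proof (re_le_Cmod z). pose proof (Rle_abs (Re z)). lra. }
  rewrite plog_right by exact H. destruct z as [x y].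
  unfold cexp, Re, Im in *; simpl in *.
  rewrite exp_ln by exact Hm. rewrite cos_atan, sin_atan.
  assert (E : Cmod (x, y) = x * sqrt (1 + (y / x)²)).
  { unfold Cmod; simpl.
    replace (x * (x * 1) + y * (y * 1)) with (x² * (1 + (y / x)²)) by (unfold Rsqr; field; lra).
    rewrite sqrt_mult, sqrt_Rsqr; try lra; [apply Rle_0_sqr |].
    pose proof (Rle_0_sqr (y / x)). lra. }
  assert (Hs : 0 < sqrt (1 + (y / x)²)).
  { apply sqrt_lt_R0. pose proof (Rle_0_sqr (y / x)). lra. }
  rewrite E. f_equal; field; lra.
Qed.

Lemma ccont_plog (z : C) : 0 < Re z -> ccont plog z.
Proof.
  intros H.
  assert (CRe : continuous (fun w : C => Re w) z) by apply (ccont_Re (fun w : C => w)), ccont_id.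
  assert (CIm : continuous (fun w : C => Im w) z) by apply (ccont_Im (fun w : C => w)), ccont_id.
  assert (Hm : 0 < Cmod z).
  { pose proof (re_le_Cmod z). pose proof (Rle_abs (Re z)). lra. }
  apply ccont_ext_loc with (fun w : C => (ln (Cmod w), atan (Im w / Re w)) : C).
  - generalize (CRe _ (open_gt 0 (Re z) H)). unfold filtermap. apply filter_imp.
    intros w Hw. symmetry. now apply plog_right.
  - apply ccont_pair.
    + apply (continuous_comp (fun w : C => Cmod w) ln).
      * apply (ccont_Cmod (fun w : C => w)), ccont_id.
      * apply continuity_pt_filterlim, derivable_continuous_pt. now exists (/ Cmod z); apply derivable_pt_lim_ln.
    + apply (continuous_comp (fun w : C => Im w / Re w) atan).
      * apply (continuous_mult (K := R_AbsRing) (fun w : C => Im w) (fun w : C => / Re w)); [exact CIm |].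
        apply (continuous_comp (fun w : C => Re w) Rinv); [exact CRe |].
        apply continuous_Rinv. lra.
      * apply continuity_pt_filterlim, derivable_continuous_pt, derivable_pt_atan.
Qed.

(* Invert Caratheodory's factorization of [cexp] at [plog z]. *)
Lemma cder_plog (z : C) : 0 < Re z -> cder plog z (/ z)%C.
Proof.
  intros H.
  assert (Hz : z <> 0) by (intros E; rewrite E in H; simpl in H; lra).
  destruct (cder_cexp (plog z)) as [p [H1 [H2 H3]]].
  rewrite cexp_plog in H2 by exact H.
  assert (Cp : ccont (fun w => p (plog w)) z).
  { apply ccont_comp; [now apply ccont_plog | exact H3]. }
  assert (Hp0 : p (plog z) <> 0) by (rewrite H2; exact Hz).
  assert (CRe : continuous (fun w : C => Re w) z) by apply (ccont_Re (fun w : C => w)), ccont_id.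
  assert (HR : locally z (fun w : C => 0 < Re w)) by exact (CRe _ (open_gt 0 (Re z) H)).
  apply cder_ext_loc with (fun w => plog z + (w - z) * / p (plog w))%C.
  - generalize (filter_and _ _ HR (ccont_neq_0 _ _ Cp Hp0)).
    apply filter_imp. intros w [Hw Hpw].
    specialize (H1 (plog w)). rewrite !cexp_plog in H1 by assumption.
    rewrite H1 at 1. field. exact Hpw.
  - exists (fun w => / p (plog w))%C. repeat split.
    + intros w. ring.
    + now rewrite H2.
    + now apply ccont_inv.
Qed.

Lemma Re_1_minus (z : C) : in_disk z -> 0 < Re (1 - z)%C.
Proof.
  intros Hz. unfold in_disk in Hz.
  pose proof (re_le_Cmod z). pose proof (Rle_abs (Re z)).
  destruct z as [x y]. unfold Re, Cminus, Cplus, Copp, RtoC in *; simpl in *. lra.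
Qed.

Lemma one_minus_neq_0 (z : C) : in_disk z -> (1 - z <> 0)%C.
Proof. intros Hz E. apply Re_1_minus in Hz. rewrite E in Hz. simpl in Hz. lra. Qed.

Lemma holo_ppow (b : R) :
  holo (fun z => ppow (1 - z) b) (fun z => - (b * ppow (1 - z) b / (1 - z)))%C.
Proof.
  assert (Hd : forall z, in_disk z ->
    cder (fun z => ppow (1 - z) b) z (- (b * ppow (1 - z) b / (1 - z)))%C).
  { intros z Hz. unfold ppow.
    apply der_eq with (b * ((0 - 1) * / (1 - z)) * cexp (b * plog (1 - z)))%C;
      [| field; now apply one_minus_neq_0].
    apply (der_comp _ z (ccont_id z) (fun z => b * plog (1 - z))%C cexp); [| apply cder_cexp].
    apply (der_scal _ z (ccont_id z) b (fun z => plog (1 - z))).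
    apply (der_comp _ z (ccont_id z) (fun z => 1 - z)%C plog).
    - apply (der_minus _ z (ccont_id z) (fun _ => RtoC 1) (fun z => z)); [apply der_const | apply der_self].
    - now apply cder_plog, Re_1_minus. }
  intros z Hz. split; [now apply Hd |].
  apply ccont_opp, ccont_div; [| | now apply one_minus_neq_0].
  - apply ccont_mult; [apply ccont_const |]. eapply cder_ccont. now apply Hd.
  - apply ccont_minus; [apply ccont_const | apply ccont_id].
Qed.

Lemma ppow_neq_0 (z : C) (b : R) : ppow z b <> 0.
Proof. apply cexp_neq_0. Qed.

Lemma ppow_1 (b : R) : ppow 1 b = 1.
Proof.
  unfold ppow. replace (plog 1) with (RtoC 0).
  - now rewrite Cmult_0_r, cexp_0.
  - rewrite plog_right by (simpl; lra). rewrite Cmod_1, ln_1. unfold Re, Im, RtoC; simpl.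
    unfold Rdiv. now rewrite Rmult_0_l, atan_0.
Qed.

Lemma Re_z_over_1_minus (z : C) : in_disk z -> - / 2 < Re (z / (1 - z))%C.
Proof.
  intros Hz. pose proof (one_minus_neq_0 z Hz) as Hne.
  destruct (Re_inv_gt_half (1 - z)) as [_ H].
  { replace (1 - (1 - z))%C with z by ring. exact Hz. }
  replace (z / (1 - z))%C with (/ (1 - z) - 1)%C by (field; exact Hne).
  unfold Cminus, Cplus, Copp, RtoC, Re in *; simpl in *. lra.
Qed.

(** * The operator [Cbeta] *)

(** The factor t z in the denominator cancels against f(tz) = t z q(tz). The endpoint t = 0, where
    the integrand is junk, does not affect the integral; for z = 0 both integrands vanish through
    their factor [z]. *)
Lemma Cbeta_radial (b : R) (f q : C -> C) (z : C) :
  (forall w, in_disk w -> f w = (w * q w)%C) -> in_disk z ->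
  Cbeta b f z = cint (fun t : R => z * (q (t * z)%C / ppow (1 - t * z) b))%C 0 1.
Proof.
  intros Hq Hz. unfold Cbeta. apply cint_ext; [lra |]. intros t Ht.
  destruct (Ceq_dec z 0) as [-> | H0]; [ring |].
  assert (Ht0 : RtoC t <> 0) by (intros E; apply RtoC_inj in E; lra).
  pose proof (ppow_neq_0 (1 - t * z) b) as Hp.
  unfold Cbeta_integrand. rewrite (Hq (t * z)%C) by (apply in_disk_scal; [lra | exact Hz]).
  field. repeat split; assumption.
Qed.

Lemma class_K_weaken (a b : R) (f : C -> C) : a <= b -> class_K b f -> class_K a f.
Proof.
  intros Hab [HA [f1 [f2 H]]]. split; [exact HA |]. exists f1, f2. intros z Hz.
  destruct (H z Hz) as (H1 & H2 & H3 & H4). refine (conj H1 (conj H2 (conj H3 _))). lra.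
Qed.

Lemma Cbeta_class_K (beta : R) (f : C -> C) :
  0 <= beta -> class_K 0 f -> class_K ((1 - beta) / 2) (Cbeta beta f).
Proof.
  intros hb [[_ [Hf0 Hf1]] [f1 [f2 H]]].
  assert (Hh : holo f f1).
  { intros z Hz. destruct (H z Hz) as (H1 & H2 & _). apply has_cderiv_cder in H1, H2.
    split; [exact H1 | now apply cder_ccont with (f2 z)]. }
  (* [class_K] provides [f2] as a derivative without continuity; a continuous version is taken here
     and agrees with [f2] on the disk by uniqueness. *)
  destruct (holo_derivative f f1 Hh) as [f2' Hh1].
  assert (E2 : forall z, in_disk z -> f2' z = f2 z).
  { intros z Hz. apply (cder_unique f1 z); [now apply Hh1 |].
    apply has_cderiv_cder. now apply H. }
  destruct (marx_strohhacker f f1 f2' Hh Hh1 Hf0) as [q [q1 [Hq HM]]].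
  { intros z Hz. rewrite (E2 z Hz). now apply H. }
  pose (P := fun z => ppow (1 - z) beta).
  pose (h := fun z => (q z / P z)%C).
  pose (h1 := fun z => ((q1 z * P z - q z * (- (beta * P z / (1 - z)))) / (P z * P z))%C).
  assert (HP : forall z, P z <> 0) by (intros z; apply ppow_neq_0).
  assert (Hhol : holo h h1).
  { intros z Hz. destruct (holo_ppow beta z Hz) as [D1 D2]. fold P in D1.
    assert (CP : ccont P z) by now apply cder_ccont with (1 := D1).
    split.
    - apply (der_div _ q P); [apply ccont_id | now apply Hq | exact D1 | apply HP].
    - apply ccont_div; [| now apply ccont_mult | now apply Cmult_neq_0].
      apply ccont_minus; apply ccont_mult; try assumption; [now apply Hq |].
      now apply (holo_ccont q q1). }
  assert (HF : forall z, in_disk z -> cder (Cbeta beta f) z (h z)).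
  { intros z Hz. apply cder_ext_loc with (fun w => cint (fun t : R => w * h (t * w)%C)%C 0 1).
    - generalize (locally_disk z 1 Hz). apply filter_imp. intros w Hw.
      symmetry. apply (Cbeta_radial beta f q); [| exact Hw]. intros x Hx. now apply HM.
    - now apply (cder_primitive h h1). }
  assert (H0 : in_disk 0) by (unfold in_disk; rewrite Cmod_0; lra).
  (* At 0 the relation f1 = q + z q1 identifies q(0) with f'(0); this normalizes the derivative of
     [Cbeta beta f]. *)
  assert (Hq0 : q 0 = 1).
  { destruct (HM 0 H0) as (_ & E & _). rewrite Cmult_0_l, Cplus_0_r in E. rewrite <- E.
    apply (cder_unique f 0); [now apply Hh | now apply has_cderiv_cder]. }
  split.
  - split; [| split].
    + intros z Hz. exists (h z). now apply has_cderiv_cder, HF.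
    + rewrite (Cbeta_radial beta f q); [| intros w Hw; now apply HM | exact H0].
      rewrite (cint_ext _ (fun _ => RtoC 0)), cint_const; [ring | lra |].
      intros t _. ring.
    + apply has_cderiv_cder. apply der_eq with (h 0); [now apply HF |].
      unfold h, P. rewrite Hq0. replace (1 - 0)%C with (RtoC 1) by ring.
      rewrite ppow_1. unfold RtoC, Cdiv, Cmult, Cinv; simpl; f_equal; field.
  - exists h, h1. intros z Hz. destruct (HM z Hz) as (_ & E1 & Hqz & Hre).
    pose proof (one_minus_neq_0 z Hz) as Hne.
    assert (Hhz : h z <> 0).
    { intros E. apply Hqz. replace (q z) with (h z * P z)%C by (unfold h; field; apply HP).
      rewrite E. ring. }
    split; [| split; [| split]].
    + now apply has_cderiv_cder, HF.
    + now apply has_cderiv_cder, Hhol.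
    + exact Hhz.
    + replace (1 + z * h1 z / h z)%C with (f1 z / q z + beta * (z / (1 - z)))%C.
      2:{ rewrite E1. unfold h1, h. field. repeat split; auto. }
      pose proof (Re_z_over_1_minus z Hz) as Hz2.
      assert (E : Re (f1 z / q z + beta * (z / (1 - z)))%C
                  = Re (f1 z / q z)%C + beta * Re (z / (1 - z))%C).
      { generalize (f1 z / q z)%C (z / (1 - z))%C. intros [x y] [x' y'].
        unfold Re, Cplus, Cmult, RtoC; simpl. ring. }
      (* The bounds 1/2 and -1/2 combine, using [0 <= beta], to (1 - beta)/2; strictness comes from
         the first term, so it persists at [beta = 0]. *)
      rewrite E. nra.
Qed.

Theorem theorem2p13 (beta : R) (hb : 0 <= beta <= 1) (f : C -> C)
  (hf : class_K 0 f) :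
  class_K ((1 - beta) / 2) (Cbeta beta f) /\ class_K 0 (Cbeta beta f).
Proof.
  assert (H : class_K ((1 - beta) / 2) (Cbeta beta f)) by now apply Cbeta_class_K.
  (* Here [beta <= 1] makes (1 - beta)/2 nonnegative. *)
  split; [exact H |]. apply class_K_weaken with (2 := H). lra.
Qed.
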